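(* Let $E$ be a commutative Noetherian ring and let $R=E[a_1,\ldots,a_m]$ be a (commutative) finitely generated $E$-algebra with generating set $\{a_1,\ldots,a_m\}$. If linear equations are solvable in $E$, then linear equations are solvable in $R$.
   Context: Linear equations are said to be solvable in a commutative Noetherian ring $\Lambda$ provided that: (i) given $\lambda,\lambda_1,\ldots,\lambda_k\in\Lambda$, there is an algorithm to determine whether $\lambda\in\langle\lambda_1,\ldots,\lambda_k\rangle$ and, if it is, to compute $\mu_1,\ldots,\mu_k\in\Lambda$ such that $\lambda=\lambda_1\mu_1+\cdots+\lambda_k\mu_k$; (ii) given $\lambda_1,\ldots,\lambda_k\in\Lambda$, there is an algorithm that computes a set of generators for the $\Lambda$-module $\{(\mu_1,\ldots,\mu_k)\in\Lambda^k\mid\lambda_1\mu_1+\cdots+\lambda_k\mu_k=0\}$. One has $R\cong E[y_1,\ldots,y_m]/I$ where $I$ is the kernel of the $E$-algebra epimorphism $E[y_1,\ldots,y_m]\to R$, $y_i\mapsto a_i$; elements of $R$ are given by representatives in $E[y_1,\ldots,y_m]$. *)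

(* Defs.v *)
From HB Require Import structures.
From mathcomp Require Import all_boot all_algebra.

Set Implicit Arguments.
Unset Strict Implicit.
Unset Printing Implicit Defensive.

Import GRing.Theory.
Local Open Scope ring_scope.

(* Total recursive functions of k arguments: the least class containing the
   initial functions and closed under composition, primitive recursion and
   minimization of regular functions (Kleene).  An algorithm between sets of
   finite data is a total recursive function on codes; lists of naturals are
   coded by the bijection CodeSeq.code : seq nat -> nat, whose inverse is
   CodeSeq.decode. *)
Inductive recursive : forall k : nat, (k.-tuple nat -> nat) -> Prop :=
| recursive_zero k : recursive (fun _ : k.-tuple nat => 0%N)
| recursive_succ : recursive (fun v : 1.-tuple nat => (thead v).+1)
| recursive_proj k (i : 'I_k) : recursive (fun v : k.-tuple nat => tnth v i)
| recursive_comp k l (g : l.-tuple nat -> nat)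
    (h : 'I_l -> k.-tuple nat -> nat) (f : k.-tuple nat -> nat) :
    recursive g -> (forall i, recursive (h i)) ->
    (forall v, f v = g [tuple h i v | i < l]) ->
    recursive f
| recursive_primrec k (g : k.-tuple nat -> nat) (h : k.+2.-tuple nat -> nat)
    (f : k.+1.-tuple nat -> nat) :
    recursive g -> recursive h ->
    (forall v : k.-tuple nat, f [tuple of 0%N :: v] = g v) ->
    (forall n (v : k.-tuple nat), f [tuple of n.+1 :: v] =
                 h [tuple of n :: f [tuple of n :: v] :: v]) ->
    recursive f
| recursive_mu k (g : k.+1.-tuple nat -> nat) (f : k.-tuple nat -> nat) :
    recursive g ->
    (forall v : k.-tuple nat, g [tuple of f v :: v] = 0%N) ->
    (forall (v : k.-tuple nat) j, (j < f v)%N -> g [tuple of j :: v] <> 0%N) ->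
    recursive f.

Definition recursive1 (f : nat -> nat) : Prop :=
  recursive (fun v : 1.-tuple nat => f (tnth v ord0)).

Definition recursive2 (f : nat -> nat -> nat) : Prop :=
  recursive (fun v : 2.-tuple nat => f (tnth v ord0) (tnth v ord_max)).

Definition in_ideal (R : comPzRingType) (k : nat) (l : 'rV[R]_k) (x : R) : Prop :=
  exists mu : 'rV[R]_k, x = \sum_(i < k) l 0 i * mu 0 i.

Definition syzygy (R : comPzRingType) (k : nat) (l mu : 'rV[R]_k) : Prop :=
  \sum_(i < k) l 0 i * mu 0 i = 0.

Definition is_ideal (R : comPzRingType) (J : R -> Prop) : Prop :=
  [/\ J 0, (forall x y, J x -> J y -> J (x + y))
    & (forall r x, J x -> J (r * x))].

Definition noetherian (R : comPzRingType) : Prop :=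
  forall J : R -> Prop, is_ideal J ->
    exists (k : nat) (g : 'rV[R]_k), forall x, J x <-> in_ideal g x.

(* A ring whose elements can be given to an algorithm and computed with: nu n is
   the element represented by the code n (an element may have many codes), and
   the ring operations are computable on codes.  Equality is not required to be
   decidable here; it is when linear equations are solvable, as x = y iff x - y
   lies in the ideal generated by the empty family. *)
Record computable_ring (R : comPzRingType) (nu : nat -> R) : Prop := {
  numbering_surjective : forall x : R, exists n : nat, nu n = x;
  computable_add : exists2 f : nat -> nat -> nat, recursive2 f &
    forall a b, nu (f a b) = nu a + nu b;
  computable_opp : exists2 f : nat -> nat, recursive1 f &
    forall a, nu (f a) = - nu a;
  computable_mul : exists2 f : nat -> nat -> nat, recursive2 f &
    forall a b, nu (f a b) = nu a * nu b
}.

(* c codes the vector v: it codes a list of exactly k codes of elements of R,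
   representing the entries of v in order. *)
Definition codes_vector (R : comPzRingType) (nu : nat -> R) (k : nat)
    (c : nat) (v : 'rV[R]_k) : Prop :=
  [seq nu n | n <- CodeSeq.decode c] = [seq v 0 i | i : 'I_k].

(* c codes the list of the rows of G. *)
Definition codes_rows (R : comPzRingType) (nu : nat -> R) (r k : nat)
    (c : nat) (G : 'M[R]_(r, k)) : Prop :=
  size (CodeSeq.decode c) = r /\
  forall j : 'I_r, codes_vector nu (nth 0%N (CodeSeq.decode c) j) (row j G).

(* Each algorithm is uniform in the number k of coefficients.  In
   solvable_membership, d decides membership (answer "yes" when nonzero) and s
   computes the coefficients; in solvable_syzygies, the row space of G over R is
   the set of all its R-linear combinations of rows. *)
Record linear_equations_solvable (R : comPzRingType) (nu : nat -> R) : Prop := {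
  solvable_computable : computable_ring nu;
  solvable_membership :
    exists d s : nat -> nat -> nat, [/\ recursive2 d, recursive2 s &
      forall (k : nat) (l : 'rV[R]_k) (x : R) (cl cx : nat),
        codes_vector nu cl l -> nu cx = x ->
        (d cx cl <> 0%N <-> in_ideal l x) /\
        (in_ideal l x -> exists2 mu : 'rV[R]_k,
           codes_vector nu (s cx cl) mu & x = \sum_(i < k) l 0 i * mu 0 i)];
  solvable_syzygies :
    exists2 g : nat -> nat, recursive1 g &
      forall (k : nat) (l : 'rV[R]_k) (cl : nat),
        codes_vector nu cl l ->
        exists (r : nat) (G : 'M[R]_(r, k)), codes_rows nu (g cl) G /\
          forall mu : 'rV[R]_k,
            syzygy l mu <-> exists b : 'rV[R]_r, mu = b *m G
}.

(* Polynomials over E in m indeterminates are given as finite lists of terms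
   (coefficient, exponents).  {mpoly E[m]} is avoided because it excludes the
   zero ring, both as base ring E and as target of evaluation.  The E-algebra
   structure of R is the structure morphism phi. *)
Definition poly_eval (E R : comPzRingType) (phi : {rmorphism E -> R}) (m : nat)
    (a : 'I_m -> R) (p : seq (E * {ffun 'I_m -> nat})) : R :=
  \sum_(t <- p) phi t.1 * \prod_(i < m) a i ^+ t.2 i.

(* R = E[a_1, ..., a_m] *)
Definition generates_algebra (E R : comPzRingType) (phi : {rmorphism E -> R})
    (m : nat) (a : 'I_m -> R) : Prop :=
  forall x : R, exists p : seq (E * {ffun 'I_m -> nat}), poly_eval phi a p = x.

(* A term is coded by the list e :: k_1 :: ... :: k_m, where e is a code of its
   coefficient and the k_i are its exponents (missing entries read as 0, extra
   ones ignored); a polynomial by the list of the codes of its terms. *)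
Definition decode_term (E : comPzRingType) (nu : nat -> E) (m c : nat) :
    E * {ffun 'I_m -> nat} :=
  (nu (nth 0%N (CodeSeq.decode c) 0),
   [ffun i : 'I_m => nth 0%N (CodeSeq.decode c) i.+1]).

Definition decode_poly (E : comPzRingType) (nu : nat -> E) (m c : nat) :
    seq (E * {ffun 'I_m -> nat}) :=
  [seq decode_term nu m t | t <- CodeSeq.decode c].

(* Elements of R = E[a_1, ..., a_m] are given by representatives in
   E[y_1, ..., y_m]. *)
Definition algebra_numbering (E R : comPzRingType) (phi : {rmorphism E -> R})
    (m : nat) (a : 'I_m -> R) (nu : nat -> E) (c : nat) : R :=
  poly_eval phi a (decode_poly nu m c).

(* Main.v *)
(* Adjoining one variable y at a time reduces the theorem to S = E[y] and then to
   a quotient S/K.  Let I be the ideal of S generated by a finite list l of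
   polynomials of degree at most D.  A finitely generated E-module N of elements
   of I of degree at most D which contains l and satisfies y N' <= N, where N'
   consists of the elements of N of degree less than D, is the whole of I in
   degrees up to D: in n_0 + y n_1 + ... + y^k n_k of degree at most D with k > 0,
   n_k lies in N', so y n_k can be absorbed into n_(k-1).  The module N' and the
   linear systems over E involved are computed from the syzygies of single
   equations over E, so that this condition is decidable; N exists because E is
   Noetherian, hence it is found by unbounded search.  Membership in I is then
   membership in N, and the same reduction shows that the syzygies of generators
   n of N are spanned by the E-linear ones and by the relations expressing
   y (c . n), for c . n generating N', as combinations of n. *)
Require Import Defs.
From HB Require Import structures.
From mathcomp Require Import all_boot all_algebra.

Set Implicit Arguments.
Unset Strict Implicit.
Unset Printing Implicit Defensive.

Import GRing.Theory.

(** * Recursive functions *)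

(** Two kinds of finite data are obtained non-effectively, and they are treated differently.
    Generators of the kernel of E[y_1, ..., y_m] -> R depend only on the rings: they exist by
    Hilbert's basis theorem and are built into the programs as constants. The module N depends on
    the input, and noetherianity gives no bound for it, so it has to be searched for; the search is
    a regular minimization because an answer is proved to exist for every input. Checking a
    candidate requires deciding equality, while an element of E may have many codes. A numbering is
    therefore first replaced by canonical codes. These pass to polynomials, since a decidable test
    for zero allows vanishing leading coefficients to be stripped. The induction on the number of
    variables has to carry noetherianity along with solvability, whence the basis theorem for
    [{poly E}]. As [{poly R}] requires 1 != 0, the zero ring is treated apart. *)

Lemma recursive_ext k (f g : k.-tuple nat -> nat) :
  f =1 g -> recursive f -> recursive g.
Proof.
(* The composition clause asks only for pointwise equality, so composing with the projections does
   the work of function extensionality. *)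
move=> fg rf; apply: (recursive_comp rf (fun i => recursive_proj i)) => v.
rewrite -fg; congr f; apply: eq_from_tnth => i; by rewrite tnth_mktuple.
Qed.

Lemma recursive_app1 k (f : nat -> nat) (g : k.-tuple nat -> nat) :
  recursive1 f -> recursive g -> recursive (fun v => f (g v)).
Proof.
move=> rf rg; apply: (recursive_comp rf (fun _ : 'I_1 => rg)) => v.
by rewrite tnth_mktuple.
Qed.

Lemma recursive_app2 k (f : nat -> nat -> nat) (g h : k.-tuple nat -> nat) :
  recursive2 f -> recursive g -> recursive h -> recursive (fun v => f (g v) (h v)).
Proof.
move=> rf rg rh.
have rgh (i : 'I_2) : recursive (fun v => if i == ord0 then g v else h v).
  by case: (i == ord0).
by apply: (recursive_comp rf rgh) => v; rewrite !tnth_mktuple.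
Qed.

Lemma recursive_const k n : recursive (fun _ : k.-tuple nat => n).
Proof.
elim: n => [|n IHn]; first exact: recursive_zero.
apply: (recursive_comp recursive_succ (fun _ : 'I_1 => IHn)) => v.
by rewrite /thead tnth_mktuple.
Qed.

Lemma recursive1_id : recursive1 id. Proof. exact: recursive_proj. Qed.

Lemma recursive1_succ : recursive1 succn.
Proof. by apply: recursive_ext recursive_succ. Qed.

Lemma recursive1_comp f g : recursive1 f -> recursive1 g -> recursive1 (f \o g).
Proof. by move=> rf; apply: (recursive_app1 rf). Qed.

Lemma recursive1_app2 f g h :
  recursive2 f -> recursive1 g -> recursive1 h -> recursive1 (fun n => f (g n) (h n)).
Proof. by move=> rf rg rh; apply: (recursive_app2 rf). Qed.

Lemma eq_recursive1 f g : f =1 g -> recursive1 f -> recursive1 g.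
Proof. by move=> fg; apply: recursive_ext => v; apply: fg. Qed.

Lemma eq_recursive2 f g : f =2 g -> recursive2 f -> recursive2 g.
Proof. by move=> fg; apply: recursive_ext => v; apply: fg. Qed.

Lemma recursive2_flip f : recursive2 f -> recursive2 (fun a b => f b a).
Proof.
by move=> rf; apply: (recursive_app2 rf); apply: recursive_proj.
Qed.

Lemma recursive2_primrec (g : nat -> nat) (h : nat -> nat -> nat -> nat) f :
  recursive1 g ->
  recursive (fun v : 3.-tuple nat => h (tnth v ord0) (tnth v (lift ord0 ord0)) (tnth v ord_max)) ->
  (forall y, f 0 y = g y) -> (forall n y, f n.+1 y = h n (f n y) y) ->
  recursive2 f.
Proof.
move=> rg rh f0 fS; apply: (recursive_primrec rg rh) => [v|n v].
  by rewrite -f0; congr f; rewrite (tuple_eta v).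
by rewrite !(tnth_nth 0) /= fS.
Qed.

Lemma recursive2_mu (g : nat -> nat -> nat) (f : nat -> nat) :
  recursive2 g -> (forall x, g (f x) x = 0) ->
  (forall x j, j < f x -> g j x <> 0) -> recursive1 f.
Proof.
move=> rg g0 gn0; apply: (recursive_mu rg) => [v|v j].
  by rewrite !(tnth_nth 0) /=.
rewrite !(tnth_nth 0) /=; exact: gn0.
Qed.

Lemma recursive2_add : recursive2 addn.
Proof.
apply: (@recursive2_primrec id (fun _ r _ => r.+1)) => //; first exact: recursive1_id.
exact: (recursive_app1 recursive1_succ (recursive_proj _)).
Qed.

Lemma recursive1_double : recursive1 double.
Proof.
apply: (eq_recursive1 addnn).
exact: (recursive1_app2 recursive2_add recursive1_id recursive1_id).
Qed.

(** This is the clause of [CodeSeq.code] for a nonempty list; 0 is the code of the empty list. The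
    same function serves as pairing, so a nonempty list and the pair of its head and tail share one
    code. *)
Definition cons_code (x c : nat) : nat := 2 ^ x * c.*2.+1.
Definition odd_code (n : nat) : nat := odd n.
Definition head_code (c : nat) : nat := head 0 (CodeSeq.decode c).
Definition tail_code (c : nat) : nat := CodeSeq.code (behead (CodeSeq.decode c)).

Lemma recursive1_primrec (f : nat -> nat) (h : nat -> nat -> nat) :
  recursive2 h -> (forall n, f n.+1 = h n (f n)) -> recursive1 f.
Proof.
move=> rh fS.
have r2 : recursive2 (fun n _ => f n).
  apply: (@recursive2_primrec (fun=> f 0) (fun n r _ => h n r)) => //.
    exact: recursive_const.
  by apply: (recursive_app2 rh); apply: recursive_proj.
exact: (recursive1_app2 r2 recursive1_id recursive1_id).
Qed.

Lemma recursive2_iter f : recursive1 f -> recursive2 (fun n x => iter n f x).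
Proof.
move=> rf; apply: (@recursive2_primrec id (fun _ r _ => f r)) => //.
  exact: recursive1_id.
exact: (recursive_app1 rf (recursive_proj _)).
Qed.

Lemma recursive2_cons_code : recursive2 cons_code.
Proof.
apply: (@recursive2_primrec (fun c => c.*2.+1) (fun _ r _ => r.*2)).
- exact: (recursive1_comp recursive1_succ recursive1_double).
- exact: (recursive_app1 recursive1_double (recursive_proj _)).
- by move=> c; rewrite /cons_code mul1n.
- by move=> n c; rewrite /cons_code expnS -mulnA mul2n.
Qed.

Lemma recursive1_not : recursive1 (fun n => n == 0 : nat).
Proof.
by apply: (@recursive1_primrec _ (fun _ _ => 0)) => //; apply: recursive_const.
Qed.

Lemma recursive1_odd : recursive1 odd_code.
Proof.
apply: (@recursive1_primrec _ (fun _ b => b == 0 : nat)).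
  exact: (recursive_app1 recursive1_not (recursive_proj _)).
by move=> n; rewrite /odd_code /=; case: (odd n).
Qed.

Lemma recursive1_half : recursive1 half.
Proof.
apply: (@recursive1_primrec _ (fun n b => odd_code n + b)).
  apply: (recursive_app2 recursive2_add); last exact: recursive_proj.
  exact: (recursive_app1 recursive1_odd (recursive_proj _)).
by move=> n; rewrite -uphalfE uphalf_half.
Qed.

Lemma cons_code_neq0 x c : cons_code x c != 0.
Proof. by rewrite muln_eq0 expn_eq0. Qed.

Lemma iter_half_cons_code j x c :
  j <= x -> iter j half (cons_code x c) = cons_code (x - j) c.
Proof.
elim: j => [|j IHj] jx; first by rewrite subn0.
by rewrite /= IHj ?(ltnW jx) // /cons_code -(subnSK jx) expnS -mulnA mul2n doubleK.
Qed.

Lemma odd_cons_code x c : odd (cons_code x c) = (x == 0).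
Proof. by rewrite oddM oddX /= odd_double andbT orbF. Qed.

Lemma code_cons x c : cons_code x c = CodeSeq.code (x :: CodeSeq.decode c).
Proof. by rewrite /cons_code /= CodeSeq.decodeK. Qed.

Lemma code_destruct c : c = 0 \/ c = cons_code (head_code c) (tail_code c).
Proof.
rewrite code_cons /tail_code /head_code CodeSeq.codeK -{1 2}(CodeSeq.decodeK c).
by case: CodeSeq.decode => [|x s]; [left | right].
Qed.

Lemma head_cons_code x c : head_code (cons_code x c) = x.
Proof. by rewrite /head_code code_cons CodeSeq.codeK. Qed.

(* The head of a nonempty list is the 2-adic valuation of its code. *)
Lemma recursive1_head_code : recursive1 head_code.
Proof.
(* Halving 0 never yields an odd number; the guard stops the minimization at once on the code 0,
   with the default head 0. *)
pose sg c w := if c is _.+1 then w else 0.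
pose g j c := sg c (odd_code (iter j half c) == 0 : nat).
apply: (@recursive2_mu g).
- have rsg : recursive2 sg.
    apply: (@recursive2_primrec (fun=> 0) (fun _ _ w => w)) => //.
      exact: recursive_const.
    exact: recursive_proj.
  apply: (recursive_app2 rsg); first exact: recursive_proj.
  apply: (recursive_app1 recursive1_not).
  apply: (recursive_app1 recursive1_odd).
  by apply: (recursive_app2 (recursive2_iter recursive1_half)); apply: recursive_proj.
- move=> c; have [-> //|->] := code_destruct c.
  move: (head_code c) (tail_code c) => x d; rewrite head_cons_code /g.
  rewrite iter_half_cons_code // subnn /odd_code odd_cons_code.
  by case: cons_code.
- move=> c j; have [-> //|->] := code_destruct c.
  move: (head_code c) (tail_code c) => x d; rewrite head_cons_code /g => jx.
  rewrite iter_half_cons_code 1?ltnW // /odd_code odd_cons_code.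
  by rewrite subn_eq0 leqNgt jx; case: cons_code (cons_code_neq0 x d).
Qed.

Lemma recursive1_tail_code : recursive1 tail_code.
Proof.
(* The last of the [(head_code c).+1] halvings drops the low bit of the odd part. *)
have r : recursive1 (fun c => iter (head_code c).+1 half c).
  apply: (recursive1_app2 (recursive2_iter recursive1_half) _ recursive1_id).
  exact: (recursive1_comp recursive1_succ recursive1_head_code).
apply: eq_recursive1 r => c; have [-> //|e] := code_destruct c.
rewrite {2}e iterS iter_half_cons_code // subnn /cons_code mul1n.
exact: (half_bit_double _ true).
Qed.

Lemma tail_cons_code x c : tail_code (cons_code x c) = c.
Proof. by rewrite /tail_code code_cons CodeSeq.codeK /= CodeSeq.decodeK. Qed.

Lemma recursive1_const n : recursive1 (fun=> n).
Proof. exact: recursive_const. Qed.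

Lemma recursive1_pair f g :
  recursive1 f -> recursive1 g -> recursive1 (fun n => cons_code (f n) (g n)).
Proof. exact: recursive1_app2 recursive2_cons_code. Qed.

(** Both branches are evaluated and packed into one code, so that the choice is a primitive
    recursion with a single parameter. *)
Lemma recursive1_if b f g : recursive1 b -> recursive1 f -> recursive1 g ->
  recursive1 (fun n => if b n == 0 then f n else g n).
Proof.
move=> rb rf rg; pose sel n p := if n == 0 then head_code p else tail_code p.
have rsel : recursive2 sel.
  apply: (@recursive2_primrec head_code (fun _ _ p => tail_code p)) => //.
    exact: recursive1_head_code.
  exact: (recursive_app1 recursive1_tail_code (recursive_proj _)).
apply: eq_recursive1 (recursive1_app2 rsel rb (recursive1_pair rf rg)) => n.
by rewrite /sel head_cons_code tail_cons_code.
Qed.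

(** A code thus supplies enough fuel for a loop over the list it codes. *)
Lemma size_leq_code s : size s <= CodeSeq.code s.
Proof.
elim: s => //= x s IHs; apply: leq_trans (leq_pmull _ (expn_gt0 2 x)).
by rewrite ltnS (leq_trans IHs) // -addnn leq_addr.
Qed.

(** The fold is an iteration on states made of the remaining list and the accumulator. The step is
    idle once the list is exhausted, so [c] rounds do no harm and are enough. *)
Lemma recursive2_foldl_code (h : nat -> nat -> nat) : recursive2 h ->
  recursive2 (fun z c => foldl h z (CodeSeq.decode c)).
Proof.
move=> rh.
pose step st := if head_code st == 0 then st else
  cons_code (tail_code (head_code st))
            (h (tail_code st) (head_code (head_code st))).
have rhh := recursive1_comp recursive1_head_code recursive1_head_code.
have rth := recursive1_comp recursive1_tail_code recursive1_head_code.
have rstep : recursive1 step.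
  apply: recursive1_if => //; [exact: recursive1_head_code|exact: recursive1_id|].
  apply: (recursive1_pair rth).
  exact: (recursive1_app2 rh recursive1_tail_code rhh).
have r : recursive2 (fun z c => tail_code (iter c step (cons_code c z))).
  apply: (recursive_app1 recursive1_tail_code).
  apply: (recursive_app2 (recursive2_iter rstep)); first exact: recursive_proj.
  by apply: (recursive_app2 recursive2_cons_code); apply: recursive_proj.
apply: eq_recursive2 r => z c.
rewrite -{2}(CodeSeq.decodeK c).
have : size (CodeSeq.decode c) <= c.
  by rewrite -{2}(CodeSeq.decodeK c) size_leq_code.
move: (CodeSeq.decode c) => s; elim: s c z => [|x s IHs] n z.
  move=> _; suff -> : iter n step (cons_code 0 z) = cons_code 0 z.
    by rewrite tail_cons_code.
  by elim: n => //= n ->; rewrite /step head_cons_code.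
case: n => // n /IHs {}IHs; rewrite iterSr [RHS]/= -IHs; congr (tail_code (iter _ _ _)).
have -> : CodeSeq.code (x :: s) = cons_code x (CodeSeq.code s) by [].
rewrite /step !head_cons_code !tail_cons_code.
by rewrite (negPf (cons_code_neq0 _ _)).
Qed.

Lemma code_rev_foldl (f : nat -> nat) s z :
  CodeSeq.code (rev (map f s) ++ CodeSeq.decode z) =
  foldl (fun a x => cons_code (f x) a) z s.
Proof.
elim: s z => [|x s IHs] z /=; first by rewrite CodeSeq.decodeK.
by rewrite -IHs rev_cons cat_rcons code_cons CodeSeq.codeK.
Qed.

Lemma recursive1_rev_map_code f : recursive1 f ->
  recursive1 (fun c => CodeSeq.code (rev (map f (CodeSeq.decode c)))).
Proof.
move=> rf; pose h a x := cons_code (f x) a.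
have rh : recursive2 h.
  apply: (recursive_app2 recursive2_cons_code); last exact: recursive_proj.
  by apply: (recursive_app1 rf); apply: recursive_proj.
have r := recursive1_app2 (recursive2_foldl_code rh) (recursive1_const 0) recursive1_id.
by apply: eq_recursive1 r => c; rewrite /h -code_rev_foldl cats0.
Qed.

Lemma recursive1_map_code f : recursive1 f ->
  recursive1 (fun c => CodeSeq.code (map f (CodeSeq.decode c))).
Proof.
move=> rf; have := recursive1_comp (recursive1_rev_map_code rf)
  (recursive1_rev_map_code recursive1_id).
apply: eq_recursive1 => c /=.
by rewrite CodeSeq.codeK map_id map_rev revK.
Qed.

(** * Computability on coded types *)

(** Every number decodes to an element, and [enc] selects one canonical code for each. Recursiveness
    of the normalization [enc (dec n)] is computability of the identity; equality is decided by
    comparing canonical codes. *)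
Class coded (T : Type) := Coded {
  enc : T -> nat;
  dec : nat -> T;
  encK : cancel enc dec;
  recursive1_canon : recursive1 (fun n => enc (dec n))
}.

#[global] Hint Mode coded ! : typeclass_instances.

Definition computable (X Y : Type) {cX : coded X} {cY : coded Y} (f : X -> Y) :=
  recursive1 (fun n => enc (f (dec n))).

Definition computable2 (X Y Z : Type) {cX : coded X} {cY : coded Y} {cZ : coded Z}
  (f : X -> Y -> Z) := recursive2 (fun m n => enc (f (dec m) (dec n))).

#[global] Instance coded_nat : coded nat :=
  @Coded nat id id (@erefl nat) recursive1_id.

Lemma recursive1_canon_bool : recursive1 (fun n => n != 0 : nat).
Proof.
apply: eq_recursive1 (recursive1_comp recursive1_not recursive1_not) => n /=.
by case: (n == 0).
Qed.

Lemma bool_encK : cancel nat_of_bool (fun n => n != 0). Proof. by case. Qed.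

#[global] Instance coded_bool : coded bool :=
  Coded bool_encK recursive1_canon_bool.

Section CodedProd.
Variables (X Y : Type) (cX : coded X) (cY : coded Y).

Definition enc_prod (p : X * Y) := cons_code (enc p.1) (enc p.2).
Definition dec_prod n : X * Y := (dec (head_code n), dec (tail_code n)).

Lemma enc_prodK : cancel enc_prod dec_prod.
Proof.
by case=> x y; rewrite /dec_prod head_cons_code tail_cons_code !encK.
Qed.

Lemma recursive1_canon_prod : recursive1 (fun n => enc_prod (dec_prod n)).
Proof.
apply: recursive1_pair.
  exact: (recursive1_comp recursive1_canon recursive1_head_code).
exact: (recursive1_comp recursive1_canon recursive1_tail_code).
Qed.

#[global] Instance coded_prod : coded (X * Y) :=
  Coded enc_prodK recursive1_canon_prod.

Definition enc_seq (s : seq X) := CodeSeq.code (map enc s).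
Definition dec_seq n : seq X := map dec (CodeSeq.decode n).

Lemma enc_seqK : cancel enc_seq dec_seq.
Proof. by move=> s; rewrite /dec_seq CodeSeq.codeK (mapK encK). Qed.

Lemma recursive1_canon_seq : recursive1 (fun n => enc_seq (dec_seq n)).
Proof.
apply: eq_recursive1 (recursive1_map_code (@recursive1_canon X cX)) => n.
by rewrite /enc_seq /dec_seq -map_comp.
Qed.

#[global] Instance coded_seq : coded (seq X) :=
  Coded enc_seqK recursive1_canon_seq.
End CodedProd.

Section Computable.
Variables (C X Y Z : Type).
Context {cC : coded C} {cX : coded X} {cY : coded Y} {cZ : coded Z}.

Lemma eq_computable (f g : X -> Y) : f =1 g -> computable f -> computable g.
Proof. by move=> fg; apply: eq_recursive1 => n; rewrite fg. Qed.

Lemma computable_id : computable (fun x : X => x).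
Proof. exact: recursive1_canon. Qed.

Lemma computable_app (f : X -> Y) (g : C -> X) :
  computable f -> computable g -> computable (fun c => f (g c)).
Proof.
move=> rf rg; apply: eq_recursive1 (recursive1_comp rf rg) => n /=.
by rewrite encK.
Qed.

Lemma computable_app2 (f : X -> Y -> Z) (g : C -> X) (h : C -> Y) :
  computable2 f -> computable g -> computable h -> computable (fun c => f (g c) (h c)).
Proof.
move=> rf rg rh; apply: eq_recursive1 (recursive1_app2 rf rg rh) => n /=.
by rewrite !encK.
Qed.

Lemma computable_const (x : X) : computable (fun _ : C => x).
Proof. exact: recursive_const. Qed.

Lemma computable_pair (f : C -> X) (g : C -> Y) :
  computable f -> computable g -> computable (fun c => (f c, g c)).
Proof. exact: recursive1_pair. Qed.

Lemma computable_fst (f : C -> X * Y) : computable f -> computable (fun c => (f c).1).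
Proof.
move=> rf; apply: eq_recursive1 (recursive1_comp recursive1_head_code rf) => n.
exact: head_cons_code.
Qed.

Lemma computable_snd (f : C -> X * Y) : computable f -> computable (fun c => (f c).2).
Proof.
move=> rf; apply: eq_recursive1 (recursive1_comp recursive1_tail_code rf) => n.
exact: tail_cons_code.
Qed.

End Computable.

Section ComputableRec.
Variables (C X Y Z : Type).
Context {cC : coded C} {cX : coded X} {cY : coded Y} {cZ : coded Z}.

Lemma computable2P (f : X -> Y -> Z) :
  computable2 f <-> computable (fun p : X * Y => f p.1 p.2).
Proof.
split=> rf.
  apply: (computable_app2 rf); [apply: computable_fst | apply: computable_snd];
    exact: computable_id.
have r : recursive2 (fun m n => enc (f (dec (cons_code m n) : X * Y).1
                                       (dec (cons_code m n) : X * Y).2)).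
  exact: (recursive_app1 rf recursive2_cons_code).
by apply: eq_recursive2 r => m n /=; rewrite head_cons_code tail_cons_code.
Qed.

Lemma computable_enc (f : C -> X) : computable f -> computable (fun c => enc (f c)).
Proof. by []. Qed.

Lemma computable_dec (f : C -> nat) : computable f -> computable (fun c => dec (f c) : X).
Proof. by move=> rf; apply: (recursive1_comp recursive1_canon rf). Qed.

Lemma computable_cons (f : C -> X) (g : C -> seq X) :
  computable f -> computable g -> computable (fun c => f c :: g c).
Proof. exact: recursive1_pair. Qed.

Lemma computable_if (b : C -> bool) (f g : C -> X) :
  computable b -> computable f -> computable g ->
  computable (fun c => if b c then f c else g c).
Proof.
move=> rb rf rg; apply: eq_recursive1 (recursive1_if rb rg rf) => n /=.
by case: (b (dec n)).
Qed.

Lemma computable_iteri (n : C -> nat) (h : C -> nat -> X -> X) (z : C -> X) :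
  computable n -> computable (fun p : C * (nat * X) => h p.1 p.2.1 p.2.2) ->
  computable z -> computable (fun c => iteri (n c) (h c) (z c)).
Proof.
move=> rn rh rz.
pose F k y := @enc X cX (iteri k (h (@dec C cC y)) (z (@dec C cC y))).
have rF : recursive2 F.
  apply: (@recursive2_primrec (fun y => @enc X cX (z (@dec C cC y)))
    (fun k r y => @enc X cX (h (@dec C cC y) k (@dec X cX r)))) => //; last first.
    by move=> k y; rewrite /F /= encK.
  apply: recursive_ext (recursive_app1 rh (recursive_app2 recursive2_cons_code
    (recursive_proj ord_max) (recursive_app2 recursive2_cons_code
    (recursive_proj ord0) (recursive_proj (lift ord0 ord0))))) => v /=.
  by rewrite !(head_cons_code, tail_cons_code).
exact: (recursive1_app2 rF rn recursive1_id).
Qed.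

(** The fold on codes takes no parameter, so the code of the context travels unchanged at the head
    of the state. *)
Lemma computable_foldl (h : C -> Y -> X -> Y) (z : C -> Y) (s : C -> seq X) :
  computable (fun p : C * (Y * X) => h p.1 p.2.1 p.2.2) -> computable z ->
  computable s -> computable (fun c => foldl (h c) (z c) (s c)).
Proof.
move=> rh rz rs.
pose H st x := cons_code (head_code st)
  (@enc Y cY (h (@dec C cC (head_code st)) (@dec Y cY (tail_code st)) (@dec X cX x))).
have rH : recursive2 H.
  have r0 := recursive_proj (ord0 : 'I_2).
  have rc := recursive_app1 recursive1_head_code r0.
  apply: (recursive_app2 recursive2_cons_code rc).
  apply: recursive_ext (recursive_app1 rh (recursive_app2 recursive2_cons_code
    rc (recursive_app2 recursive2_cons_code (recursive_app1 recursive1_tail_code r0)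
    (recursive_proj (ord_max : 'I_2))))) => v /=.
  by rewrite !(head_cons_code, tail_cons_code).
have r := recursive1_app2 (recursive2_foldl_code rH) (recursive1_pair recursive1_id rz) rs.
apply: eq_recursive1 (recursive1_comp recursive1_tail_code r) => n /=.
rewrite CodeSeq.codeK; move: (z (dec n)) (s (dec n)) => y t.
elim: t y => [|x t IHt] y /=; first exact: tail_cons_code.
by rewrite {2}/H !(head_cons_code, tail_cons_code) !encK.
Qed.

(** Minimization over the codes of [X] is regular because a witness exists for every [c].
    Certificates, coefficients and representatives in the quotient are all found in this way. *)
Lemma computable_search (P : C -> X -> bool) : computable2 P ->
  (forall c, exists x, P c x) ->
  exists2 f : C -> X, computable f & forall c, P c (f c).
Proof.
move=> rP exP.
have exn n : exists k, P (dec n) (dec k).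
  by have [x Px] := exP (dec n); exists (enc x); rewrite encK.
exists (fun c => dec (ex_minn (exn (enc c)))); last first.
  by move=> c; case: ex_minnP => k; rewrite encK.
suff r : recursive1 (fun n => ex_minn (exn n)).
  exact: (recursive1_comp (recursive1_comp (@recursive1_canon X cX) r)
                          (@recursive1_canon C cC)).
pose g k n : nat := nat_of_bool (P (@dec C cC n) (@dec X cX k)) == 0.
apply: (recursive2_mu (g := g)).
- exact: (recursive_app1 recursive1_not (recursive2_flip rP)).
- by move=> n; rewrite /g; case: ex_minnP => k ->.
- move=> n j; rewrite /g; case: ex_minnP => k _ min jk.
  by case: (boolP (P _ _)) => // /min; rewrite leqNgt jk.
Qed.
End ComputableRec.

(* [comp] decomposes a goal [computable (fun c => t)] along the head symbol of t;
   the matching is syntactic, as unification could unfold the algebraic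
   operations forever.  [comp_hook] receives the symbols introduced later on. *)
Ltac comp_hook F := fail.
Ltac comp_step :=
  lazymatch goal with
  | |- @computable _ _ _ _ ?F =>
    lazymatch F with
    | (fun c => c) => exact: computable_id
    | (fun _ => ?x) => exact: computable_const
    | (fun c => fst (@?f c)) => apply: computable_fst
    | (fun c => snd (@?f c)) => apply: computable_snd
    | (fun c => (@?f c, @?g c)) => apply: computable_pair
    | (fun c => @?f c :: @?g c) => apply: computable_cons
    | _ => first
      [ comp_hook F
      | lazymatch goal with
        | H : computable F |- _ => exact H
        | H : computable ?g |- computable (fun c => ?g (@?f c)) =>
            apply: (computable_app (f := g) H)
        | H : computable2 ?g |- computable (fun c => ?g (@?f c) (@?h c)) =>
            apply: (computable_app2 (f := g) H)
        end
      | lazymatch goal with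
        | |- computable (fun _ => _) => fail
        | |- @computable ?A _ _ _ _ => change (computable (fun c : A => F c))
        end ]
    end
  end.
Ltac comp := repeat comp_step.

(** * Computable operations on numbers and lists *)

Section ComputableSeq.
Variables (C X Y : Type).
Context {cC : coded C} {cX : coded X} {cY : coded Y}.

Lemma computable_succ (n : C -> nat) : computable n -> computable (fun c => (n c).+1).
Proof. exact: recursive1_comp recursive1_succ. Qed.

Lemma computable_pred (n : C -> nat) : computable n -> computable (fun c => (n c).-1).
Proof.
move=> rn; have r : computable (fun c => iteri (n c) (fun k _ => k) 0).
  by apply: computable_iteri; comp.
by apply: eq_computable r => c; case: (n c).
Qed.

Lemma computable_add (m n : C -> nat) :
  computable m -> computable n -> computable (fun c => m c + n c).
Proof. exact: recursive1_app2 recursive2_add. Qed.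

Lemma computable_negb (a : C -> bool) : computable a -> computable (fun c => ~~ a c).
Proof.
move=> ra; have r : computable (fun c => if a c then false else true).
  by apply: computable_if; comp.
by apply: eq_computable r => c; case: (a c).
Qed.

Lemma computable_andb (a b : C -> bool) :
  computable a -> computable b -> computable (fun c => a c && b c).
Proof. by move=> ra rb; apply: computable_if; comp. Qed.

Lemma computable_rev (s : C -> seq X) : computable s -> computable (fun c => rev (s c)).
Proof.
move=> rs; have r : computable (fun c => foldl (fun a x => x :: a) [::] (s c)).
  by apply: computable_foldl; comp.
apply: eq_computable r => c; rewrite /rev; move: [::] (s c) => t u.
by elim: u t => //= x u IHu t; rewrite IHu.
Qed.

Lemma computable_behead (s : C -> seq X) :
  computable s -> computable (fun c => behead (s c)).
Proof.
move=> rs; apply: eq_recursive1 (recursive1_comp recursive1_tail_code rs) => n /=.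
by rewrite /tail_code /= /enc_seq CodeSeq.codeK; case: (s _).
Qed.

Lemma computable_head (z : C -> X) (s : C -> seq X) :
  computable z -> computable s -> computable (fun c => head (z c) (s c)).
Proof.
move=> rz rs; have r := recursive1_comp recursive1_head_code rs.
apply: eq_recursive1 (recursive1_if rs rz r) => n /=.
case: (s _) => [|x t] //=; rewrite /enc_seq /=.
have -> : 2 ^ enc x * (CodeSeq.code (map enc t)).*2.+1 =
          cons_code (enc x) (CodeSeq.code (map enc t)) by [].
by rewrite (negPf (cons_code_neq0 _ _)) head_cons_code.
Qed.
End ComputableSeq.

Section ComputableSeq2.
Variables (C X Y : Type).
Context {cC : coded C} {cX : coded X} {cY : coded Y}.

Lemma computable_sub (m n : C -> nat) :
  computable m -> computable n -> computable (fun c => m c - n c).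
Proof.
move=> rm rn; have r : computable (fun c => iteri (n c) (fun _ k => k.-1) (m c)).
  by apply: computable_iteri; comp; apply: computable_pred; comp.
by apply: eq_computable r => c; elim: (n c) => [|k /= ->]; rewrite ?subn0 ?subnS.
Qed.

Lemma computable_eq0 (n : C -> nat) : computable n -> computable (fun c => n c == 0).
Proof. exact: recursive1_comp recursive1_not. Qed.

Lemma computable_foldr (h : C -> X -> Y -> Y) (z : C -> Y) (s : C -> seq X) :
  computable (fun p : C * (X * Y) => h p.1 p.2.1 p.2.2) -> computable z ->
  computable s -> computable (fun c => foldr (h c) (z c) (s c)).
Proof.
move=> rh rz rs.
have r : computable (fun c => foldl (fun y x => h c x y) (z c) (rev (s c))).
  apply: computable_foldl => //; last exact: computable_rev.
  by apply: (computable_app (g := fun p : C * (Y * X) => (p.1, (p.2.2, p.2.1))) rh); comp.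
by apply: eq_computable r => c; rewrite foldl_rev.
Qed.

Lemma computable_nth (z : C -> X) (s : C -> seq X) (n : C -> nat) :
  computable z -> computable s -> computable n ->
  computable (fun c => nth (z c) (s c) (n c)).
Proof.
move=> rz rs rn.
have r : computable (fun c => head (z c) (iteri (n c) (fun=> behead) (s c))).
  apply: computable_head => //; apply: computable_iteri => //.
  by apply: computable_behead; comp.
apply: eq_computable r => c; rewrite -nth0.
suff -> : iteri (n c) (fun=> behead) (s c) = drop (n c) (s c) by rewrite nth_drop addn0.
by elim: (n c) => [|k /= ->]; rewrite ?drop0 // -drop1 drop_drop.
Qed.
End ComputableSeq2.

Section ComputableSeq3.
Variables (C X Y : Type).
Context {cC : coded C} {cX : coded X} {cY : coded Y}.

Lemma computable_leq (m n : C -> nat) :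
  computable m -> computable n -> computable (fun c => m c <= n c).
Proof. by move=> rm rn; apply: computable_eq0; apply: computable_sub. Qed.

Lemma computable_cat (s t : C -> seq X) :
  computable s -> computable t -> computable (fun c => s c ++ t c).
Proof.
move=> rs rt; have r : computable (fun c => foldr cons (t c) (s c)).
  by apply: computable_foldr; comp.
by apply: eq_computable r => c; elim: (s c) => //= x u ->.
Qed.

Lemma computable_map (h : C -> X -> Y) (s : C -> seq X) :
  computable (fun p : C * X => h p.1 p.2) -> computable s ->
  computable (fun c => map (h c) (s c)).
Proof.
move=> rh rs; rewrite /map.
have r : computable (fun c => foldr (fun x t => h c x :: t) [::] (s c)).
  apply: computable_foldr; comp.
  by apply: (computable_app (g := fun p : C * (X * seq Y) => (p.1, p.2.1)) rh); comp.
by apply: eq_computable r => c; elim: (s c) => //= x u ->.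
Qed.

Lemma computable_size (s : C -> seq X) : computable s -> computable (fun c => size (s c)).
Proof.
move=> rs; have r : computable (fun c => foldr (fun _ n => n.+1) 0 (s c)).
  by apply: computable_foldr; comp; apply: computable_succ; comp.
by apply: eq_computable r => c; elim: (s c) => //= x u ->.
Qed.

Lemma computable_all (h : C -> X -> bool) (s : C -> seq X) :
  computable (fun p : C * X => h p.1 p.2) -> computable s ->
  computable (fun c => all (h c) (s c)).
Proof.
move=> rh rs; have r : computable (fun c => foldr (fun x b => h c x && b) true (s c)).
  apply: computable_foldr; comp; apply: computable_andb; comp.
  by apply: (computable_app (g := fun p : C * (X * bool) => (p.1, p.2.1)) rh); comp.
by apply: eq_computable r => c; elim: (s c) => //= x u ->.
Qed.

Lemma computable_mkseq (h : C -> nat -> X) (n : C -> nat) :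
  computable (fun p : C * nat => h p.1 p.2) -> computable n ->
  computable (fun c => mkseq (h c) (n c)).
Proof.
move=> rh rn.
have r : computable (fun c => rev (iteri (n c) (fun k s => h c k :: s) [::])).
  apply: computable_rev; apply: computable_iteri; comp.
  by apply: (computable_app (g := fun p : C * (nat * seq X) => (p.1, p.2.1)) rh); comp.
apply: eq_computable r => c.
by rewrite -[RHS]revK; congr rev; elim: (n c) => //= k ->; rewrite mkseqS rev_rcons.
Qed.
End ComputableSeq3.

Lemma computable_sumn C (cC : coded C) (s : C -> seq nat) :
  computable s -> computable (fun c => sumn (s c)).
Proof. by move=> rs; apply: computable_foldr; comp; apply: computable_add; comp. Qed.

Lemma computable_eq C (X : eqType) (cC : coded C) (cX : coded X) (f g : C -> X) :
  computable f -> computable g -> computable (fun c => f c == g c).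
Proof.
move=> rf rg; have r : computable (fun c => (enc (f c) <= enc (g c)) && (enc (g c) <= enc (f c))).
  by apply: computable_andb; apply: computable_leq; apply: computable_enc.
apply: eq_computable r => c; rewrite -eqn_leq.
by apply/eqP/eqP => [|-> //]; apply: (can_inj encK).
Qed.

Local Open Scope ring_scope.

(** * Linear combinations and finitely generated ideals *)

(* A vector of coefficients (v_0, ..., v_(k-1)) is the polynomial v of size at
   most k; the coefficients of index at least [size G] are ignored. *)
Definition lincomb (R : comNzRingType) (M : lmodType R) (G : seq M) (v : {poly R}) : M :=
  \sum_(0 <= i < size G) v`_i *: G`_i.

Section LinComb.
Variables (R : comNzRingType) (M : lmodType R).
Implicit Types (x : M) (G : seq M) (v w : {poly R}).

Fact lincomb_is_linear G : linear (lincomb G).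
Proof.
move=> a v w; rewrite /lincomb scaler_sumr -big_split; apply: eq_bigr => i _.
by rewrite coefD coefZ scalerDl scalerA.
Qed.
HB.instance Definition _ G :=
  GRing.isLinear.Build R {poly R} M *:%R (lincomb G) (lincomb_is_linear G).

Lemma eq_lincomb G v w :
  (forall i, (i < size G)%N -> v`_i = w`_i) -> lincomb G v = lincomb G w.
Proof. by move=> vw; apply: eq_big_nat => i /vw ->. Qed.

Lemma lincomb_take G v : lincomb G (take_poly (size G) v) = lincomb G v.
Proof. by apply: eq_lincomb => i iG; rewrite coef_take_poly iG. Qed.

Lemma lincomb_cat G G' v :
  lincomb (G ++ G') v = lincomb G v + lincomb G' (drop_poly (size G) v).
Proof.
rewrite /lincomb size_cat (big_cat_nat (n := size G)) ?leq_addr //=; congr (_ + _).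
  by apply: eq_big_nat => i /= iG; rewrite nth_cat iG.
rewrite -{1}[size G]add0n big_addn addKn; apply: eq_bigr => i _.
by rewrite nth_cat ltnNge leq_addl addnK coef_drop_poly.
Qed.

(** Coefficient vectors are glued by a shift; [v] is cut first, as its entries beyond [size G],
    ignored by [G], would otherwise act on [G']. *)
Lemma lincomb_cat_take G G' v w :
  lincomb (G ++ G') (take_poly (size G) v + w * 'X^(size G)) = lincomb G v + lincomb G' w.
Proof.
rewrite lincomb_cat drop_polyDMXn ?size_take_poly //; congr (_ + _).
by apply: eq_lincomb => i iG; rewrite coefD coefMXn coef_take_poly iG addr0.
Qed.

Lemma lincomb_cons x G v :
  lincomb (x :: G) v = v`_0 *: x + lincomb G (drop_poly 1 v).
Proof. by rewrite -cat1s lincomb_cat /lincomb /= big_nat1. Qed.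

Lemma lincombXn G i : (i < size G)%N -> lincomb G 'X^i = G`_i.
Proof.
move=> iG; rewrite /lincomb big_mkord (bigD1 (Ordinal iG)) //= coefXn eqxx scale1r.
rewrite big1 ?addr0 // => j ji; rewrite coefXn -val_eqE /= in ji *.
by rewrite (negPf ji) scale0r.
Qed.

Lemma lincomb_closed (P : M -> Prop) G v :
  P 0 -> (forall x y, P x -> P y -> P (x + y)) -> (forall a x, P x -> P (a *: x)) ->
  (forall x, x \in G -> P x) -> P (lincomb G v).
Proof.
move=> P0 PD PZ PG; rewrite /lincomb big_mkord; elim/big_ind: _ => // i _.
exact/PZ/PG/mem_nth.
Qed.

Lemma linear_lincomb (N : lmodType R) (f : {linear M -> N}) G v :
  f (lincomb G v) = lincomb (map f G) v.
Proof.
rewrite linear_sum /lincomb size_map; apply: eq_big_nat => i /andP[_ iG].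
by rewrite linearZ /= (nth_map 0).
Qed.
End LinComb.

Lemma size_lincomb (R : comNzRingType) (G : seq {poly R}) v k :
  (forall x, x \in G -> size x <= k)%N -> (size (lincomb G v) <= k)%N.
Proof.
move=> Gk; apply: (lincomb_closed (P := fun x : {poly R} => (size x <= k)%N)) => //.
- by rewrite size_poly0.
- by move=> x y xk yk; rewrite (leq_trans (size_polyD _ _)) // geq_max xk.
- by move=> a x; apply: leq_trans (size_scale_leq _ _).
Qed.

Lemma lincomb_basis (R : comNzRingType) k (v : {poly R}) :
  (size v <= k)%N ->
  lincomb (mkseq (fun i => 'X^i) k) v = v.
Proof.
move=> vk; rewrite /lincomb size_mkseq -[RHS](take_poly_id vk) /take_poly poly_def.
rewrite big_mkord; apply: eq_bigr => i _; by rewrite nth_mkseq.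
Qed.

(** The size bounds are essential: without them the kernel of [lincomb l] contains every vector
    supported beyond [size l], and no finite list generates it. *)
Definition generates_syzygies (R : comNzRingType) (M : lmodType R) (l : seq M)
    (G : seq {poly R}) : Prop :=
  (forall g, g \in G -> size g <= size l)%N /\
  forall v : {poly R}, (size v <= size l)%N ->
    (lincomb l v = 0 <-> exists b, v = lincomb G b).

Definition finitely_generated_ideals (R : comNzRingType) : Prop :=
  forall J : R -> Prop, is_ideal J ->
    exists l : seq R, forall x, J x <-> exists v, x = lincomb (l : seq R^o) v.

(** Finite choice, by induction on the list, from mere existence. *)
Lemma list_choice (S T : eqType) (P : S -> Prop) (f : S -> T) (l : seq T) :
  (forall t, t \in l -> exists2 s, P s & f s = t) ->
  exists2 r : seq S, map f r = l & forall s, s \in r -> P s.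
Proof.
elim: l => [|t l IHl] Pl; first by exists [::].
have [|r fr Pr] := IHl; first by move=> u ul; apply: Pl; rewrite inE ul orbT.
have [|s Ps fs] := Pl t; first by rewrite inE eqxx.
exists (s :: r); first by rewrite /= fs fr.
by move=> u; rewrite inE => /predU1P[->|/Pr].
Qed.

(** * Hilbert's basis theorem *)

Section HilbertBasis.
Variable E : comNzRingType.
Hypothesis noethE : finitely_generated_ideals E.

Lemma coef_lincomb (n : seq {poly E}) v D :
  (lincomb n v)`_D = lincomb ([seq (x : {poly E})`_D | x <- n] : seq E^o) v.
Proof. exact: (linear_lincomb (coefp D : {linear {poly E} -> E^o})). Qed.

(** Induction on [D]: the coefficients of X^D in elements of [N] of size at most D+1 form an ideal
    of E. Lifts of its generators are added to the list, and subtracting a combination of them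
    lowers the size to [D]. *)
Lemma submodule_bounded_fg (D : nat) (N : {poly E} -> Prop) :
  N 0 -> (forall x y, N x -> N y -> N (x + y)) -> (forall a x, N x -> N (a *: x)) ->
  exists n : seq {poly E}, (forall x, x \in n -> N x /\ (size x <= D)%N) /\
    forall x, N x -> (size x <= D)%N -> exists e, x = lincomb n e.
Proof.
move=> N0 ND NZ; elim: D => [|D [n [nN nD]]].
  exists [::]; split=> // x _; rewrite leqn0 size_poly_eq0 => /eqP ->.
  by exists 0; rewrite linear0.
pose V x := N x /\ (size x <= D.+1)%N.
have VD x y : V x -> V y -> V (x + y).
  move=> [Nx sx] [Ny sy]; split; first exact: ND.
  by rewrite (leq_trans (size_polyD _ _)) // geq_max sx.
have VZ a x : V x -> V (a *: x).
  by move=> [Nx sx]; split; [exact: NZ | apply: leq_trans (size_scale_leq _ _) sx].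
have V0 : V 0 by split=> //; rewrite size_poly0.
pose J c := exists2 x, V x & x`_D = c.
have [|l Jl] := noethE (J := J).
  split; first by exists 0; rewrite ?coef0.
    by move=> _ _ [x Vx <-] [y Vy <-]; exists (x + y); [exact: VD | rewrite coefD].
  by move=> r _ [x Vx <-]; exists (r *: x); [exact: VZ | rewrite coefZ].
have [c cl|r rl Vr] := @list_choice _ _ V (fun x : {poly E} => x`_D) l.
  apply/Jl; exists 'X^(index c l); rewrite lincombXn ?index_mem //.
  by rewrite (nth_index _ cl).
exists (r ++ n); split=> [x|x Nx sx].
  by rewrite mem_cat => /orP[/Vr [] //|/nN[Nx sx]]; split=> //; apply: leqW.
have [v xv] : exists v, x`_D = lincomb (l : seq E^o) v by apply/Jl; exists x.
have Vy : V (x - lincomb r v).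
  rewrite -scaleN1r; apply: (VD) => //; apply: (VZ).
  exact: (lincomb_closed _ V0 VD VZ Vr).
have [||e ye] := nD (x - lincomb r v).
- by case: Vy.
- apply/leq_sizeP => j; rewrite leq_eqVlt => /predU1P[<-|Dj].
    by rewrite coefB coef_lincomb rl -xv subrr.
  by apply: (leq_sizeP _ _ _) Dj; case: Vy.
exists (take_poly (size r) v + e * 'X^(size r)).
by rewrite lincomb_cat_take -ye addrC subrK.
Qed.

Lemma lincomb_polyC (n : seq {poly E}) e :
  lincomb n e = lincomb (n : seq {poly E}^o) (map_poly polyC e).
Proof. by apply: eq_bigr => i _; rewrite coef_map /= -mul_polyC. Qed.

(** Leading coefficient argument. Generators of the ideal [L] of leading coefficients are realized
    in one common degree [D] by multiplying with powers of X. Their multiples lower every degree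
    above [D], and the elements of degree at most [D] form a finitely generated E-module. *)
Theorem hilbert_basis : finitely_generated_ideals {poly E}.
Proof.
move=> J [J0 JD JM].
(* Here [d] only bounds the degree of [f], so [c] may vanish; this makes [L] closed under addition,
   once both summands are shifted to degree d+d'. *)
pose L c := exists d, exists2 f, J f /\ (size f <= d.+1)%N & f`_d = c.
have shift f d k : J f -> (size f <= d.+1)%N ->
    [/\ J (f * 'X^k), (size (f * 'X^k)%R <= (d + k).+1)%N & (f * 'X^k)`_(d + k) = f`_d].
  move=> Jf sf; split; first by rewrite mulrC; apply: JM.
    by rewrite -addSn (leq_trans (size_polyMleq _ _)) // size_polyXn addnS /= leq_add2r.
  by rewrite coefMXn ltnNge leq_addl addnK.
have [|l Ll] := noethE (J := L).
  split.
  - by exists 0, 0; rewrite ?coef0 ?size_poly0.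
  - move=> _ _ [d [f [Jf sf] <-]] [d' [f' [Jf' sf'] <-]]; exists (d + d')%N.
    have [Jg sg <-] := shift f d d' Jf sf; have [Jh sh <-] := shift f' d' d Jf' sf'.
    exists (f * 'X^d' + f' * 'X^d); last by rewrite coefD [(d' + d)%N]addnC.
    split; first exact: JD.
    by rewrite (leq_trans (size_polyD _ _)) // geq_max sg addnC.
  - move=> r _ [d [f [Jf sf] <-]]; exists d, (r *: f); last by rewrite coefZ.
    by rewrite -mul_polyC; split; [exact: JM | rewrite mul_polyC (leq_trans (size_scale_leq _ _))].
have [D DL] : exists D, forall c, c \in l ->
    exists2 f, J f /\ (size f <= D.+1)%N & f`_D = c.
  have : forall c, c \in l -> L c.
    move=> c cl; apply/Ll; exists 'X^(index c l).
    by rewrite lincombXn ?index_mem // (nth_index _ cl).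
  elim: l {Ll} => [|c l IHl] lL; first by exists 0%N.
  have [|D DL] := IHl; first by move=> c' c'l; apply: lL; rewrite inE c'l orbT.
  have [|d [f [Jf sf] fc]] := lL c; first by rewrite inE eqxx.
  exists (d + D)%N => c'; rewrite inE => /predU1P[->|/DL [g [Jg sg] gc]].
    by have [Jh sh hc] := shift f d D Jf sf; exists (f * 'X^D) => //; rewrite hc.
  have [Jh sh hc] := shift g D d Jg sg.
  by rewrite addnC; exists (g * 'X^d) => //; rewrite hc.
have [r rl rJ] := list_choice DL.
have JZ a x : J x -> J (a *: x) by rewrite -mul_polyC; apply: JM.
have [n [nJ nD]] := submodule_bounded_fg D.+1 J0 JD JZ.
exists n => f; split=> [|[v ->]]; last first.
  exact: (@lincomb_closed _ {poly E}^o J n v J0 JD JM (fun x xn => (nJ x xn).1)).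
have [k] := ubnP (size f); elim: k f => // k IHk f; rewrite ltnS => fk Jf.
have [sf|sf] := leqP (size f) D.+1.
  by have [e ->] := nD f Jf sf; exists (map_poly polyC e); rewrite lincomb_polyC.
set d := (size f).-1; have sfd : size f = d.+1 by rewrite prednK // (leq_trans _ sf).
have Dd : (D < d)%N by rewrite -ltnS -sfd.
have [v fv] : exists v, f`_d = lincomb (l : seq E^o) v.
  by apply/Ll; exists d, f => //; rewrite sfd.
pose g := lincomb r v.
have Jg : J g := lincomb_closed _ J0 JD JZ (fun x xr => (rJ x xr).1).
have sg : (size g <= D.+1)%N by apply: size_lincomb => x /rJ[].
have [Jh sh hd] := shift g D (d - D)%N Jg sg; rewrite (subnKC (ltnW Dd)) in sh hd.
have [||w fw] := IHk (f - g * 'X^(d - D)).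
- apply: leq_trans fk; rewrite sfd ltnS; apply/leq_sizeP => j.
  rewrite leq_eqVlt => /predU1P[<-|dj].
    by rewrite coefB hd /g coef_lincomb rl fv subrr.
  rewrite coefB (leq_sizeP _ _ sh) // subr0.
  by apply: nth_default; rewrite sfd.
- by apply: JD => //; rewrite -mulN1r; apply: JM.
(* The reducing polynomial [g] itself has degree at most [D], hence is a combination of [n]; so [n]
   alone generates [J]. *)
have [e ge] := nD g Jg sg.
exists (w + 'X^(d - D) *: map_poly polyC e).
rewrite linearD linearZ /= -fw -lincomb_polyC -ge.
by rewrite /GRing.scale /= [_ * g]mulrC subrK.
Qed.
End HilbertBasis.

(** * Syzygies *)

Lemma lincomb_comp (R : comNzRingType) (M : lmodType R) (l : seq M) (G : seq {poly R}) b :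
  lincomb l (lincomb G b) = lincomb [seq lincomb l g | g <- G] b.
Proof. exact: linear_lincomb. Qed.

Lemma coefM_top (R : comNzRingType) (p q : {poly R}) a b :
  (size p <= a.+1)%N -> (size q <= b.+1)%N -> (p * q)`_(a + b) = p`_a * q`_b.
Proof.
move=> pa qb; have ia : (a < (a + b).+1)%N by rewrite ltnS leq_addr.
rewrite coefM (bigD1 (Ordinal ia)) //= addKn big1 ?addr0 // => i.
rewrite -val_eqE /= neq_ltn => /orP[ia'|ai].
  by rewrite [q`_ _]nth_default ?mulr0 // (leq_trans qb) // ltn_subRL ltn_add2r.
by rewrite nth_default ?mul0r // (leq_trans pa).
Qed.

Section TransferSyzygies.
Variables (R : comNzRingType) (M : lmodType R) (l n : seq M).
Variables (P Q G : seq {poly R}).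
Hypotheses (Pl : [seq lincomb n p | p <- P] = l) (Qn : [seq lincomb l q | q <- Q] = n).
Hypotheses (sP : forall p, p \in P -> (size p <= size n)%N)
  (sQ : forall q, q \in Q -> (size q <= size l)%N).
Hypothesis Gn : generates_syzygies n G.

(* With n = Q l and l = P n, an identity v l = 0 yields v P n = 0, and
   v = v (1 - P Q) + (v P) Q. *)
Definition transfer_syzygies : seq {poly R} :=
  mkseq (fun i => 'X^i - lincomb Q P`_i) (size l) ++ [seq lincomb Q g | g <- G].

Lemma generates_transfer_syzygies : generates_syzygies l transfer_syzygies.
Proof.
have sPl : size P = size l by rewrite -Pl size_map.
have sQb b : (size (lincomb Q b) <= size l)%N by apply: size_lincomb.
(* The first block consists of the rows of 1 - P Q. *)
have gen v : lincomb (mkseq (fun i => 'X^i - lincomb Q P`_i) (size l)) v =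
    take_poly (size l) v - lincomb Q (lincomb P v).
  rewrite lincomb_comp /take_poly poly_def /lincomb size_mkseq size_map sPl big_mkord.
  rewrite big_mkord -sumrB; apply: eq_bigr => i _.
  by rewrite nth_mkseq // scalerBr (nth_map 0) ?sPl.
split=> [g|v sv].
  rewrite mem_cat => /orP[/mapP[i]|/mapP[h _ ->] //].
  rewrite mem_iota /= => il ->; rewrite (leq_trans (size_polyD _ _)) //.
  by rewrite geq_max size_polyN sQb size_polyXn il.
split=> [lv|[b ->]].
  have sPv : (size (lincomb P v) <= size n)%N by apply: size_lincomb.
  have [b Pvb] : exists b, lincomb P v = lincomb G b.
    by apply/(Gn.2 _ sPv); rewrite lincomb_comp Pl.
  exists (take_poly (size l) v + b * 'X^(size l)).
  rewrite -{1}(size_mkseq (fun i => 'X^i - lincomb Q P`_i) (size l)).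
  rewrite -{2}(size_mkseq (fun i => 'X^i - lincomb Q P`_i) (size l)).
  rewrite lincomb_cat_take gen -lincomb_comp -Pvb take_poly_id // subrK //.
have lQ u : lincomb l (lincomb Q u) = lincomb n u by rewrite lincomb_comp Qn.
have nP u : lincomb n (lincomb P u) = lincomb l u by rewrite lincomb_comp Pl.
rewrite lincomb_cat size_mkseq gen -lincomb_comp linearD linearB /=.
rewrite lincomb_take !lQ nP subrr add0r.
set w := drop_poly _ _; apply/(Gn.2 _ _).2; last by exists w.
by apply: size_lincomb; case: Gn.
Qed.
End TransferSyzygies.

(** * Ideals of E[y] in bounded degree *)

Section Truncation.
Variables (E : comNzRingType) (D : nat) (n : seq {poly E}) (C B : seq {poly E}).
Hypotheses (sn : forall x, x \in n -> (size x <= D.+1)%N)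
  (sB : forall b, b \in B -> (size b <= size n)%N)
  (genC : generates_syzygies ([seq (x : {poly E})`_D | x <- n] : seq E^o) C)
  (CB : [seq 'X * lincomb n c | c <- C] = [seq lincomb n b | b <- B]).

(** [n] and [nS] are the same list: combinations of [n] have coefficients in E, those of [nS] in S =
    E[y]. [up] regards a vector over E as a vector of constants of S. *)
Let S : comNzRingType := {poly E}.
Let nS : seq S^o := n.
Let up : {poly E} -> {poly S} := map_poly polyC.

(** Two levels of polynomials meet here: the outer variable of [{poly S}] marks the position in a
    vector, and the constant ['X%:P] is the scalar y. The entries are the vectors y c - b. *)
Definition shift_relations : seq {poly S} :=
  mkseq (fun i => 'X%:P * up C`_i - up B`_i) (size C).

Let sCB : size C = size B. Proof. by have := congr1 size CB; rewrite !size_map. Qed.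

Let nup e : lincomb nS (up e) = lincomb n e. Proof. by rewrite -lincomb_polyC. Qed.

Let lincomb_rel (v : {poly E}) :
  lincomb shift_relations (up v) = 'X *: up (lincomb C v) - up (lincomb B v).
Proof.
rewrite /lincomb size_mkseq -sCB !big_mkord.
rewrite /up !rmorph_sum scaler_sumr -sumrB /=; apply: eq_bigr => i _.
rewrite nth_mkseq // coef_map /= scalerBr -!mul_polyC !rmorphM /= !map_polyC.
by rewrite mulrCA.
Qed.

Let rel_syz r : r \in shift_relations -> lincomb nS r = 0.
Proof.
case/mapP=> i; rewrite mem_iota /= => iC ->.
rewrite linearB /= mul_polyC linearZ /= !nup.
have := congr1 (fun s => s`_i) CB; rewrite !(nth_map 0) -?sCB // => <-.
exact: subrr.
Qed.

Let size_up v : (size (up v) <= size v)%N. Proof. exact: size_poly. Qed.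

Let size_rel r : r \in shift_relations -> (size r <= size n)%N.
Proof.
case/mapP=> i; rewrite mem_iota /= => iC ->.
rewrite (leq_trans (size_polyD _ _)) // geq_max size_polyN mul_polyC.
rewrite (leq_trans (size_scale_leq _ _)) ?(leq_trans (size_up _)) //=.
  by apply: sB; apply: mem_nth; rewrite -sCB.
by rewrite -(size_map (fun x : {poly E} => x`_D) n); apply: genC.1; apply: mem_nth.
Qed.

(* Descending induction on the degree in y of the coefficients of h: the top
   ones form a syzygy of the coefficients of y^D in n, hence can be lowered
   by means of the relations y c - b. *)
Lemma truncation (k : nat) (h : {poly S}) : (size h <= size n)%N ->
  (forall j, size (h`_j)%R <= k.+1)%N -> (size (lincomb nS h : {poly E}) <= D.+1)%N ->
  exists w (e : {poly E}), (size e <= size n)%N /\ h = lincomb shift_relations w + up e.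
Proof.
elim: k h => [|k IHk] h sh hk nh.
  exists 0, (map_poly (coefp 0) h); split; first by rewrite (leq_trans (size_poly _ _)).
  rewrite linear0 add0r; apply/polyP => j; rewrite !coef_map /=.
  by rewrite -size1_polyC.
pose g := map_poly (coefp k.+1) h.
have sg : (size g <= size n)%N by rewrite (leq_trans (size_poly _ _)).
have [a ga] : exists a, g = lincomb C a.
  apply/(genC.2 g); first by rewrite size_map.
  (* Only the top coefficients of [h] and the coefficients of y^D in [n] contribute to degree k+1+D,
     which exceeds the degree of the combination. *)
  have nh0 : (lincomb nS h)`_(k.+1 + D) = 0 :> E.
    by apply: nth_default; rewrite (leq_trans nh) // addSn ltnS leq_addl.
  rewrite -[RHS]nh0 /lincomb size_map coef_sum; apply: eq_big_nat => i /andP[_ ni].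
  rewrite coef_map (nth_map 0) //=; apply/esym/coefM_top => //.
  exact: sn (mem_nth _ ni).
(* Subtracting y^k (y g - B a) from [h] cancels its part y^(k+1) g at the price of y^k B a, which is
   of lower degree; the value on [nS] is unchanged. *)
pose q := 'X^k *: lincomb shift_relations (up a).
have nq : lincomb nS q = 0.
  rewrite linearZ /= lincomb_comp.
  rewrite (@lincomb_closed _ _ (fun x : S^o => x = 0)) ?scaler0 //.
  - by move=> x y -> ->; rewrite addr0.
  - by move=> c x ->; rewrite scaler0.
  - by move=> x /mapP[r /rel_syz rn ->].
have sq : (size q <= size n)%N.
  by rewrite (leq_trans (size_scale_leq _ _)) // size_lincomb.
have [|j||w [e [se he]]] := IHk (h - q).
- by rewrite (leq_trans (size_polyD _ _)) // geq_max sh size_polyN.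
- rewrite /q lincomb_rel -ga coefB coefZ coefB coefZ !coef_map /=.
  apply/leq_sizeP => i; rewrite mulrBr mulrA -exprSr !coefB !(coefXnM, coefMC).
  rewrite leq_eqVlt => /predU1P[<-|ki].
    rewrite ltnn subnn ltnNge leqnSn /= !coefC eqxx subSnn /= subr0; exact: subrr.
  rewrite nth_default ?(leq_trans (hk j)) // ltnNge (ltnW ki) /= ltnNge.
  rewrite (leq_trans _ (ltnW ki)) //= !coefC !subn_eq0 leqNgt ki /=.
  by rewrite leqNgt (ltn_trans _ ki) //= !subr0.
- by rewrite linearB /= nq subr0.
exists (w + 'X^k *: up a), e; split=> //.
rewrite linearD linearZ /= -/q addrAC -he; exact/esym/subrK.
Qed.

Lemma truncate (h : {poly S}) : (size h <= size n)%N ->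
  (size (lincomb nS h : {poly E}) <= D.+1)%N ->
  exists w (e : {poly E}), (size e <= size n)%N /\ h = lincomb shift_relations w + up e.
Proof.
move=> sh; apply: (@truncation (\max_(j < size h) size (h`_j)%R)) => // j.
apply: leqW; have [jh|hj] := ltnP j (size h); last by rewrite nth_default ?size_poly0.
exact: (leq_bigmax (Ordinal jh)).
Qed.

Let relE w : lincomb nS (lincomb shift_relations w) = 0.
Proof.
rewrite lincomb_comp (@lincomb_closed _ _ (fun x : S^o => x = 0)) //.
- by move=> x y -> ->; rewrite addr0.
- by move=> c x ->; rewrite scaler0.
- by move=> x /mapP[r /rel_syz rn ->].
Qed.

Lemma bounded_ideal_membership (f : {poly E}) : (size f <= D.+1)%N ->
  (exists v, f = lincomb nS v) <-> exists e, f = lincomb n e.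
Proof.
move=> sf; split=> [[v fv]|[e ->]]; last by exists (up e); rewrite nup.
have [||w [e [_ he]]] := @truncate (take_poly (size n) v).
- exact: size_take_poly.
- by rewrite (lincomb_take nS) -fv.
by exists e; rewrite fv -(lincomb_take nS) he linearD /= relE add0r nup.
Qed.

(** The value 0 of a syzygy has bounded degree, so [truncate] applies to it; the remainder [e] is
    then an E-linear syzygy of [n]. *)
Lemma generates_shift_relations (G : seq {poly E}) : generates_syzygies n G ->
  generates_syzygies nS (shift_relations ++ map up G).
Proof.
move=> [sG genG]; split=> [g|v sv].
  rewrite mem_cat => /orP[/size_rel //|/mapP[b /sG sb ->]].
  exact: leq_trans (size_up _) sb.
have upG b : up (lincomb G b) = lincomb (map up G) (up b).
  rewrite /lincomb size_map /up rmorph_sum /=; apply: eq_big_nat => i /andP[_ iG].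
  by rewrite (nth_map 0) // coef_map -!mul_polyC rmorphM /= map_polyC.
split=> [nv|[b ->]].
  have [|w [e [se ve]]] := truncate sv; first by rewrite nv size_poly0.
  have [b eb] : exists b, e = lincomb G b.
    apply/(genG e se); rewrite -nup -[RHS]nv ve linearD /= relE; exact/esym/add0r.
  exists (take_poly (size shift_relations) w + up b * 'X^(size shift_relations)).
  by rewrite lincomb_cat_take -upG -eb.
rewrite lincomb_cat linearD /= relE add0r lincomb_comp -map_comp.
rewrite (@lincomb_closed _ _ (fun x : S^o => x = 0)) //.
- by move=> x y -> ->; rewrite addr0.
- by move=> c x ->; rewrite scaler0.
move=> x /mapP[g gG ->] /=; rewrite nup; apply/(genG g (sG g gG)).
by exists 'X^(index g G); rewrite lincombXn ?index_mem // nth_index.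
Qed.
End Truncation.

(** * Systems of linear equations over E *)

Section LinearSystem.
Variables (E : comNzRingType) (syz : seq E -> seq {poly E}).
Hypothesis syzP : forall l : seq E, generates_syzygies (l : seq E^o) (syz l).

(** On the solutions of the preceding equations, parametrized by [G], the equation in degree [i]
    becomes a single equation for the parameters; its syzygies are substituted back. The iteration
    starts from the standard basis. *)
Definition system_step (n : seq {poly E}) (i : nat) (G : seq {poly E}) :=
  [seq lincomb G c | c <- syz [seq (lincomb n g)`_i | g <- G]].

Definition system_syzygies (n : seq {poly E}) (D : nat) : seq {poly E} :=
  iteri D (system_step n) (mkseq (fun i => 'X^i) (size n)).

Lemma size_system_syzygies n D g : g \in system_syzygies n D -> (size g <= size n)%N.
Proof.
elim: D g => [|D IHD] g /=; first by case/mapP=> i; rewrite mem_iota => ? ->; rewrite size_polyXn.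
by case/mapP=> c _ ->; apply: size_lincomb.
Qed.

Lemma system_syzygiesP (n : seq {poly E}) D (v : {poly E}) : (size v <= size n)%N ->
  (forall i, (i < D)%N -> (lincomb n v)`_i = 0) <->
  exists b, v = lincomb (system_syzygies n D) b.
Proof.
elim: D v => [|D IHD] v sv.
  by split=> // _; exists v; rewrite lincomb_basis.
have -> : system_syzygies n D.+1 = system_step n D (system_syzygies n D) by [].
rewrite /system_step; set G := system_syzygies n D in IHD *; set l := map _ G.
have [sC genC] := syzP l.
have nG b : (lincomb n (lincomb G b))`_D = lincomb (l : seq E^o) b.
  by rewrite lincomb_comp coef_lincomb -map_comp.
split=> [nv|[c vc]].
  have [i iD|b vb] := (IHD v sv).1; first by apply: nv; apply: leqW.
  have [c bc] : exists c, take_poly (size G) b = lincomb (syz l) c.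
    apply/genC; first by rewrite size_map size_take_poly.
    by rewrite -nG lincomb_take -vb nv.
  by exists c; rewrite -lincomb_comp -bc lincomb_take.
rewrite -lincomb_comp in vc; move=> i; rewrite ltnS leq_eqVlt => /predU1P[->|iD].
  rewrite vc nG; apply/genC; last by exists c.
  exact: size_lincomb.
by apply: (IHD v sv).2 iD; exists (lincomb (syz l) c).
Qed.

Lemma generates_system_syzygies (n : seq {poly E}) D : (forall x, x \in n -> (size x <= D)%N) ->
  generates_syzygies n (system_syzygies n D).
Proof.
move=> sn; split=> [|v sv]; first exact: size_system_syzygies.
have [coef0P genP] := system_syzygiesP D sv.
split=> [nv|/genP nv]; first by apply: coef0P => i _; rewrite nv coef0.
apply/polyP => i; rewrite coef0; have [/nv //|Di] := ltnP i D.
by apply: nth_default; rewrite (leq_trans (size_lincomb _ sn)).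
Qed.

(* x is a combination of n exactly when 1 occurs as first coordinate of a
   syzygy of x :: n. *)
Lemma system_membership (x : {poly E}) (n : seq {poly E}) D :
  (forall y, y \in x :: n -> (size y <= D)%N) ->
  (exists v, 1 = lincomb ([seq (g : {poly E})`_0 | g <- system_syzygies (x :: n) D] : seq E^o) v)
  <-> exists e, x = lincomb n e.
Proof.
move=> sn; have [sG genG] := generates_system_syzygies sn.
set G := system_syzygies _ _ in sG genG *.
have xv v : lincomb (x :: n) v = v`_0 *: x + lincomb n (drop_poly 1 v).
  exact: lincomb_cons.
split=> [[v]|[e xe]].
  rewrite -coef_lincomb => v1; exists (- drop_poly 1 (lincomb G v)).
  have /genG : (size (lincomb G v) <= size (x :: n))%N by apply: size_lincomb.
  move=> [_ /(_ (ex_intro _ v erefl))]; rewrite xv -v1 scale1r linearN /= => /eqP.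
  by rewrite addr_eq0 => /eqP.
(* The vector (1, -e), with [e] cut to the length of [n]. *)
pose w := 1 - take_poly (size n) e * 'X.
have sw : (size w <= size (x :: n))%N.
  rewrite (leq_trans (size_polyD _ _)) // geq_max size_poly1 size_polyN /=.
  rewrite (leq_trans (size_polyMleq _ _)) // size_polyX addn2 ltnS size_take_poly //.
have [v wv] : exists v, w = lincomb G v.
  apply/(genG w sw); rewrite xv coefB coef1 coefMX subr0 scale1r /w linearB /=.
  have -> : drop_poly 1 (1 : {poly E}) = 0.
    by apply/polyP => i; rewrite coef_drop_poly coef1 coef0 addn1.
  rewrite -['X]expr1 drop_polyMXn_id sub0r linearN /= lincomb_take -xe; exact: subrr.
exists v; rewrite -coef_lincomb -wv coefB coef1 coefMX; exact/esym/subr0.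
Qed.
End LinearSystem.

(** * Computability over coded rings *)

Section CodedPoly.
Variables (R : comNzRingType) (cR : coded R).

Definition enc_poly (p : {poly R}) : nat := enc (p : seq R).
Definition dec_poly (n : nat) : {poly R} := Poly (dec n : seq R).

Lemma enc_polyK : cancel enc_poly dec_poly.
Proof. by move=> p; rewrite /dec_poly encK polyseqK. Qed.

(** This is the normalization of coded polynomials: zeros are stripped from the end of the
    coefficient list, which uses the decidable equality of [R]. *)
Lemma computable_polyseq_Poly (C : Type) (cC : coded C) (s : C -> seq R) :
  computable s -> computable (fun c => polyseq (Poly (s c))).
Proof.
move=> rs.
have r : computable (fun c => foldr (fun x t =>
    if (x == 0) && (size t == 0)%N then [::] else x :: t) [::] (s c)).
  apply: computable_foldr; comp; apply: computable_if; comp.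
  apply: computable_andb; first by apply: computable_eq; comp.
  by apply: computable_eq0; apply: computable_size; comp.
apply: eq_computable r => c; elim: (s c) => [|x t IHt] /=; first by rewrite polyseq0.
by rewrite IHt polyseq_cons /nilp polyseqC; case: (x == 0); case: (polyseq (Poly t)).
Qed.

#[global] Instance coded_poly : coded {poly R} :=
  Coded enc_polyK (computable_polyseq_Poly (computable_id (X := seq R))).
End CodedPoly.

Class computable_ops (R : comNzRingType) {cR : coded R} : Prop := ComputableOps {
  computable_addr : computable2 (fun x y : R => x + y);
  computable_mulr : computable2 (fun x y : R => x * y)
}.
Arguments computable_ops R {cR}.

Section RingOps.
Context {R : comNzRingType} {cR : coded R} {oR : computable_ops R}.
Context {C X : Type} {cC : coded C} {cX : coded X}.

Lemma computable_polyseq (f : C -> {poly R}) :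
  computable f -> computable (fun c => polyseq (f c)).
Proof. by []. Qed.

Lemma computable_poly (n : C -> nat) (h : C -> nat -> R) : computable n ->
  computable (fun p : C * nat => h p.1 p.2) ->
  computable (fun c => \poly_(i < n c) h c i).
Proof.
move=> rn rh; have r := computable_polyseq_Poly (computable_mkseq rh rn).
have {}r : computable (fun c => Poly (mkseq (h c) (n c))) by [].
apply: eq_computable r => c; apply/polyP => i; rewrite coef_Poly coef_poly.
case: ifP => [ic|/negbT]; first by rewrite nth_mkseq.
by rewrite -leqNgt => ci; rewrite nth_default // size_mkseq.
Qed.

Lemma computable_coef (f : C -> {poly R}) (n : C -> nat) :
  computable f -> computable n -> computable (fun c => (f c)`_(n c)).
Proof. by move=> rf rn; apply: (@computable_nth C R); comp. Qed.

Lemma computable_addR (f g : C -> R) :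
  computable f -> computable g -> computable (fun c => f c + g c).
Proof. exact: (computable_app2 computable_addr). Qed.

Lemma computable_mulR (f g : C -> R) :
  computable f -> computable g -> computable (fun c => f c * g c).
Proof. exact: (computable_app2 computable_mulr). Qed.

Lemma computable_oppR (f : C -> R) : computable f -> computable (fun c => - f c).
Proof.
move=> rf; have r : computable (fun c => -1 * f c) by apply: computable_mulR; comp.
by apply: eq_computable r => c; rewrite mulN1r.
Qed.
End RingOps.

Section Sum.
Variables (M : nmodType) (C X : Type) (cM : coded M) (cC : coded C) (cX : coded X).

Lemma computable_sum (s : C -> seq X) (F : C -> X -> M) :
  computable2 (fun x y : M => x + y) -> computable s ->
  computable (fun p : C * X => F p.1 p.2) ->
  computable (fun c => \sum_(x <- s c) F c x).
Proof.
move=> rD rs rF; have r : computable (fun c => foldr (fun x y => F c x + y) 0 (s c)).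
  apply: computable_foldr; comp.
  by apply: (computable_app (g := fun p : C * (X * M) => (p.1, p.2.1)) rF); comp.
by apply: eq_computable r => c; elim: (s c) => [|x t /= ->]; rewrite ?big_nil ?big_cons.
Qed.
End Sum.

Lemma computable_lincomb (R : comNzRingType) (M : lmodType R) (cR : coded R)
    (cM : coded M) (C : Type) (cC : coded C) (G : C -> seq M) (v : C -> {poly R}) :
  computable2 (fun x y : M => x + y) -> computable2 (fun a (x : M) => a *: x) ->
  computable G -> computable v -> computable (fun c => lincomb (G c) (v c)).
Proof.
move=> rD rZ rG rv.
have r : computable (fun c => \sum_(i <- mkseq id (size (G c))) (v c)`_i *: (G c)`_i).
  apply: computable_sum => //; first by apply: computable_mkseq; comp; apply: computable_size.
  apply: (computable_app2 rZ).
    by apply: computable_coef; comp; apply: (computable_app rv); comp.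
  by apply: computable_nth; comp; apply: (computable_app rG); comp.
by apply: eq_computable r => c; rewrite /lincomb /mkseq map_id /index_iota subn0.
Qed.

Section PolyOps.
Context {R : comNzRingType} {cR : coded R} {oR : computable_ops R}.

#[global] Instance computable_ops_poly : computable_ops {poly R}.
Proof.
split; apply/computable2P.
- have r : computable (fun p : {poly R} * {poly R} =>
      \poly_(i < size p.1 + size p.2) (p.1`_i + p.2`_i)).
    apply: computable_poly.
      by apply: computable_add; apply: computable_size; apply: computable_polyseq; comp.
    by apply: computable_addR; apply: computable_coef; comp.
  apply: eq_computable r => -[p q] /=; apply/polyP => i; rewrite coef_poly coefD.
  case: ltnP => // pqi; rewrite !nth_default ?addr0 //.
    exact: leq_trans (leq_addl _ _) pqi.
  exact: leq_trans (leq_addr _ _) pqi.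
- have r : computable (fun p : {poly R} * {poly R} =>
      \poly_(i < size p.1 + size p.2) \sum_(j <- mkseq id i.+1) p.1`_j * p.2`_(i - j)).
    apply: computable_poly.
      by apply: computable_add; apply: computable_size; apply: computable_polyseq; comp.
    apply: computable_sum; first exact: computable_addr.
      by apply: computable_mkseq; comp; apply: computable_succ; comp.
    apply: computable_mulR; apply: computable_coef; comp.
    by apply: computable_sub; comp.
  apply: eq_computable r => -[p q] /=; apply/polyP => i; rewrite coef_poly.
  case: ltnP => [_|pqi].
    by rewrite coefM /mkseq map_id -[iota _ _]/(index_iota 0 i.+1) big_mkord.
  by rewrite nth_default // (leq_trans (size_polyMleq _ _)) // (leq_trans (leq_pred _)).
Qed.

Context {C : Type} {cC : coded C}.

Lemma computable_polyC (f : C -> R) : computable f -> computable (fun c => (f c)%:P).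
Proof.
move=> rf; have r : computable (fun c => \poly_(i < 1) f c).
  by apply: computable_poly; comp; apply: (computable_app rf); comp.
by apply: eq_computable r => c; apply/polyP => -[|i]; rewrite coef_poly coefC.
Qed.

Lemma computable_polyXn (n : C -> nat) :
  computable n -> computable (fun c => 'X^(n c) : {poly R}).
Proof.
move=> rn.
have r : computable (fun c => \poly_(i < (n c).+1) (if i == n c then 1 else 0 : R)).
  apply: computable_poly; first exact: computable_succ.
  apply: computable_if; comp.
  by apply: computable_eq; comp; apply: (computable_app rn); comp.
apply: eq_computable r => c; apply/polyP => i; rewrite coef_poly coefXn.
by case: eqP => [->|_]; [rewrite ltnSn | case: ifP].
Qed.

End PolyOps.

Section LincombOps.
Context {R : comNzRingType} {cR : coded R} {oR : computable_ops R}.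
Context {C : Type} {cC : coded C}.

Lemma computable2_scale_poly : computable2 (fun a (p : {poly R}) => a *: p).
Proof.
apply/computable2P.
have r : computable (fun c : R * {poly R} => c.1%:P * c.2).
  by apply: computable_mulR; comp; apply: computable_polyC; comp.
by apply: eq_computable r => c; rewrite mul_polyC.
Qed.

Lemma computable_lincomb_poly (G : C -> seq {poly R}) (v : C -> {poly R}) :
  computable G -> computable v -> computable (fun c => lincomb (G c) (v c)).
Proof.
apply: (@computable_lincomb R {poly R}); last exact: computable2_scale_poly.
exact: (@computable_addr {poly R}).
Qed.

Lemma computable_lincomb_regular (G : C -> seq R) (v : C -> {poly R}) :
  computable G -> computable v ->
  computable (fun c => lincomb (G c : seq R^o) (v c) : R).
Proof.
apply: (@computable_lincomb R R^o _ cR); first exact: (@computable_addr R).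
exact: (@computable_mulr R).
Qed.
End LincombOps.

Lemma computable_map_polyC (R : comNzRingType) {cR : coded R} {oR : computable_ops R}
    (C : Type) {cC : coded C} (f : C -> {poly R}) :
  computable f -> computable (fun c => map_poly polyC (f c)).
Proof.
move=> rf; apply: computable_poly; first exact: computable_size (computable_polyseq rf).
by apply: computable_polyC; apply: computable_coef; comp.
Qed.

(** The form of solvability that passes through the induction, over canonical codes. It asks for no
    coefficients in a membership: once membership is decided, they can be found by search. *)
Record solvable_ring (R : comNzRingType) (cR : coded R) : Prop := SolvableRing {
  solvable_ops : computable_ops R;
  solvable_mem : exists2 d : R -> seq R -> bool, computable2 d &
    forall x l, d x l <-> exists v, x = lincomb (l : seq R^o) v;
  solvable_syz : exists2 g : seq R -> seq {poly R}, computable g &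
    forall l, generates_syzygies (l : seq R^o) (g l)
}.

Ltac comp_hook F ::=
  lazymatch F with
  | (fun c => @?f c + @?g c) => apply: computable_addR
  | (fun c => - @?f c) => apply: computable_oppR
  | (fun c => @?f c * @?g c) => apply: computable_mulR
  | (fun c => polyX _ ^+ @?n c) => apply: computable_polyXn
  | (fun c => polyC (@?f c)) => apply: computable_polyC
  | (fun c => map_poly polyC (@?f c)) => apply: computable_map_polyC
  | (fun c => polyseq (@?f c)) => apply: computable_polyseq
  | (fun c => lincomb (@?G c) (@?v c)) =>
      first [apply: computable_lincomb_poly | apply: computable_lincomb_regular]
  | (fun c => nth (@?z c) (@?s c) (@?n c)) => apply: computable_nth
  | (fun c => cat (@?s c) (@?t c)) => apply: computable_cat
  | (fun c => map (@?h c) (@?s c)) => apply: computable_map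
  | (fun c => all (@?h c) (@?s c)) => apply: computable_all
  | (fun c => size (@?s c)) => apply: computable_size
  | (fun c => mkseq (@?h c) (@?n c)) => apply: computable_mkseq
  | (fun c => sumn (@?s c)) => apply: computable_sumn
  | (fun c => leq (@?m c) (@?n c)) => apply: computable_leq
  | (fun c => eq_op (@?f c) (@?g c)) => apply: computable_eq
  | (fun c => (@?f c).+1) => apply: computable_succ
  | (fun c => @?f c && @?g c) => apply: computable_andb
  | (fun c => ~~ @?f c) => apply: computable_negb
  end.

(** * Linear equations in E[y] *)

Section PolynomialRing.
Variables (E : comNzRingType) (cE : coded E).
Hypotheses (noethE : finitely_generated_ideals E) (solvE : solvable_ring cE).
Let S : comNzRingType := {poly E}.

(* A certificate (Q, P, B) describes n = Q l with l = P n and y (c . n) = b . n, for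
   c in a generating set of the syzygies of the coefficients of y^D in n and b in B. *)
Definition certificate := (seq {poly S} * seq {poly S} * seq {poly E})%type.

Definition certified_basis (l : seq S) (t : certificate) : seq S :=
  [seq lincomb (l : seq S^o) q | q <- t.1.1].

(** All memberships are witnessed by the lists of the certificate and none is to be decided, so that
    checking needs only arithmetic, equality and syzygies over E. *)
Definition certifies (syz : seq E -> seq {poly E}) (l : seq S) (D : nat)
    (t : certificate) : bool :=
  let n := certified_basis l t in
  [&& all (fun q : {poly S} => size q <= size l)%N t.1.1,
      all (fun x : {poly E} => size x <= D.+1)%N n,
      [seq lincomb (n : seq S^o) p | p <- t.1.2] == l,
      all (fun p : {poly S} => size p <= size n)%N t.1.2,
      all (fun b : {poly E} => size b <= size n)%N t.2 &
      [seq 'X * lincomb (n : seq {poly E}) c | c <- syz [seq (x : {poly E})`_D | x <- n]]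
        == [seq lincomb (n : seq {poly E}) b | b <- t.2] ].

(* A generating set of the E-module of all elements of degree at most D of the
   ideal yields a certificate. *)
Lemma certificate_exists syz l D :
  (forall k : seq E, generates_syzygies (k : seq E^o) (syz k)) ->
  all (fun x : {poly E} => size x <= D.+1)%N l -> exists t, certifies syz l D t.
Proof.
move=> syzP /allP sl.
pose N (x : {poly E}) := exists v, x = lincomb (l : seq S^o) v.
have N0 : N 0 by exists 0; rewrite linear0.
have ND x y : N x -> N y -> N (x + y).
  by move=> [v ->] [w ->]; exists (v + w); rewrite linearD.
have NM r x : N x -> N (r * x) by move=> [v ->]; exists (r *: v); rewrite linearZ.
have NZ a x : N x -> N (a *: x) by rewrite -mul_polyC; apply: NM.
have [n [nN nD]] := submodule_bounded_fg noethE D.+1 N0 ND NZ.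
have [|Q Qn sQ] := @list_choice _ _ (fun q : {poly S} => (size q <= size l)%N)
    (fun q => lincomb (l : seq S^o) q : S) n.
  move=> x /nN[[v ->] _]; exists (take_poly (size l) v); first exact: size_take_poly.
  exact: (lincomb_take (l : seq S^o)).
have [|P Pl sP] := @list_choice _ _ (fun p : {poly S} => (size p <= size n)%N)
    (fun p => lincomb (n : seq S^o) p : S) l.
  move=> x xl; have [|e xe] := nD x _ (sl x xl).
    exists 'X^(index x l); rewrite lincombXn ?index_mem //; exact/esym/nth_index.
  exists (map_poly polyC (take_poly (size n) e)).
    by rewrite (leq_trans (size_poly _ _)) // size_take_poly.
  by rewrite -lincomb_polyC lincomb_take.
have [sC genC] := syzP [seq (x : {poly E})`_D | x <- n]; set C := syz _ in sC genC *.
have [|B CB sB] := @list_choice _ _ (fun b : {poly E} => (size b <= size n)%N)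
    (fun b => lincomb n b) [seq 'X * lincomb n c | c <- C].
  move=> x /mapP[c cC ->].
  (* As [c] is a syzygy of the coefficients of y^D, the combination has degree below [D], and its
     product with y stays within the bound. *)
  have sc : (size (lincomb n c) <= D)%N.
    apply/leq_sizeP => j; rewrite leq_eqVlt => /predU1P[<-|Dj].
      rewrite coef_lincomb; apply/(genC c (sC c cC)).
      by exists 'X^(index c C); rewrite lincombXn ?index_mem // nth_index.
    by apply: nth_default; apply: leq_trans Dj; apply: size_lincomb => y /nN[].
  have [||e ->] := nD ('X * lincomb n c).
  - by apply: NM; apply: (lincomb_closed _ N0 ND NZ) => y /nN[].
  - by rewrite (leq_trans (size_polyMleq _ _)) // size_polyX.
  by exists (take_poly (size n) e); rewrite ?size_take_poly ?lincomb_take.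
exists (Q, P, B); rewrite /certifies /certified_basis /= Qn Pl CB !eqxx /=.
apply/and5P; split=> //; apply/allP => //.
by move=> x /nN[].
Qed.

Section Certified.
Variables (syz : seq E -> seq {poly E}) (l : seq S) (D : nat) (t : certificate).
Hypothesis syzP : forall k : seq E, generates_syzygies (k : seq E^o) (syz k).
Hypothesis lt : certifies syz l D t.
Let n := certified_basis l t.

Lemma size_certified_basis x : x \in n -> (size (x : {poly E}) <= D.+1)%N.
Proof. by case/and5P: lt => _ /allP sn _ _ _; apply: sn. Qed.

Lemma certified_basis_ideal (x : S) :
  (exists v, x = lincomb (l : seq S^o) v) <-> exists v, x = lincomb (n : seq S^o) v.
Proof.
case/and5P: lt => _ _ /eqP lE _ _; rewrite -/n in lE.
split=> -[v ->].
  by exists (lincomb t.1.2 v); rewrite lincomb_comp lE.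
by exists (lincomb t.1.1 v); rewrite lincomb_comp.
Qed.

Lemma certified_membership (x : S) : (size (x : {poly E}) <= D.+1)%N ->
  (exists v, x = lincomb (l : seq S^o) v) <-> exists e, x = lincomb (n : seq {poly E}) e.
Proof.
case/and5P: (lt) => _ _ _ _ /andP[/allP sB /eqP CB] sx.
apply: (iff_trans (certified_basis_ideal x)).
exact: bounded_ideal_membership size_certified_basis sB (syzP _) CB _ sx.
Qed.

Definition certified_syzygies : seq {poly S} :=
  transfer_syzygies (l : seq S^o) t.1.2 t.1.1
    (shift_relations (syz [seq (x : {poly E})`_D | x <- n]) t.2
     ++ map (map_poly polyC) (system_syzygies syz n D.+1)).

Lemma generates_certified_syzygies :
  generates_syzygies (l : seq S^o) certified_syzygies.
Proof.
case/and5P: (lt) => /allP sQ _ /eqP lE /allP sP /andP[/allP sB /eqP CB].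
apply: (@generates_transfer_syzygies S S^o l n t.1.2 t.1.1 _ lE (erefl _) sP sQ).
apply: generates_shift_relations size_certified_basis sB (syzP _) CB _ _.
exact: generates_system_syzygies size_certified_basis.
Qed.
End Certified.

Lemma computable_system_syzygies (C : Type) {cC : coded C} {oE : computable_ops E} syz
    (n : C -> seq {poly E}) (D : C -> nat) :
  computable syz -> computable n -> computable D ->
  computable (fun c => system_syzygies syz (n c) (D c)).
Proof.
move=> rsyz rn rD; rewrite /system_syzygies /system_step.
by apply: computable_iteri; comp.
Qed.

Theorem solvable_poly : solvable_ring (coded_poly cE).
Proof.
have [oE [d rd dP] [syz rsyz syzP]] := solvE.
pose ok (c : seq S * nat) := all (fun x : {poly E} => size x <= c.2.+1)%N c.1.
(* The search has to succeed on every input, so inputs exceeding the degree bound are accepted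
   vacuously. *)
pose P (c : seq S * nat) t := ~~ ok c || certifies syz c.1 c.2 t.
have rP : computable2 P.
  apply/computable2P; rewrite /P /ok /certifies /certified_basis.
  by apply: computable_if; comp; cbv zeta; comp.
have [|cert rcert certP] := computable_search rP.
  move=> c; have [okc|nok] := boolP (ok c); last first.
    by exists ([::], [::], [::]); rewrite /P nok.
  by have [t ct] := certificate_exists syzP okc; exists t; rewrite /P ct orbT.
(* Any computable bound of the degrees will do; the sum of the sizes is one. *)
pose deg (l : seq S) := sumn [seq size (x : {poly E}) | x <- l].
have deg_mem l x : x \in l -> (size (x : {poly E}) <= deg l)%N.
  by elim: l => // y l IHl; rewrite inE /deg /= => /predU1P[->|/IHl]; rewrite ?leq_addr //;
     move/leq_trans; apply; rewrite leq_addl.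
have certD l D : (deg l <= D)%N -> certifies syz l D (cert (l, D)).
  move=> lD; have := certP (l, D); rewrite /P /ok /=; case: allP => // -[] x xl.
  exact: leqW (leq_trans (deg_mem l x xl) lD).
split; first exact: computable_ops_poly.
(* Membership of [x] becomes membership of 1 in the ideal of E generated by the first coordinates of
   the E-linear syzygies of [x] followed by the certified basis. Degrees 0 to D give D+1
   equations. *)
- exists (fun x l => d 1 [seq (g : {poly E})`_0 | g <- system_syzygies syz
    ((x : {poly E}) :: certified_basis l (cert (l, deg (x :: l)))) (deg (x :: l)).+1]).
    apply/computable2P; rewrite /deg /certified_basis; comp.
    by apply: computable_system_syzygies; comp.
  move=> x l; set D := deg _; set n := certified_basis _ _.
  have lt : certifies syz l D (cert (l, D)) by apply: certD; rewrite /D /deg leq_addl.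
  have sx : (size (x : {poly E}) <= D.+1)%N by apply/leqW/deg_mem; rewrite inE eqxx.
  have sn (y : {poly E}) : y \in (x : {poly E}) :: n -> (size y <= D.+1)%N.
    by rewrite inE => /predU1P[-> //|]; apply: (size_certified_basis lt).
  apply: (iff_trans (dP _ _)); apply: (iff_trans (system_membership syzP sn)).
  exact: iff_sym (certified_membership syzP lt sx).
exists (fun l => certified_syzygies syz l (deg l) (cert (l, deg l))).
  rewrite /certified_syzygies /transfer_syzygies /shift_relations /certified_basis /deg.
  by comp; apply: computable_system_syzygies; comp.
by move=> l; apply: generates_certified_syzygies (certD _ _ (leqnn _)).
Qed.
End PolynomialRing.

(** * Numberings and quotients *)

Section Rows.
Variable R : comNzRingType.

Lemma dot_row (k : nat) (l mu : 'rV[R]_k) :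
  \sum_(i < k) l 0 i * mu 0 i = lincomb ([seq l 0 i | i : 'I_k] : seq R^o) (rVpoly mu).
Proof.
rewrite /lincomb size_image card_ord big_mkord; apply: eq_bigr => i _.
rewrite coef_rVpoly_ord mulrC (nth_map i) ?size_enum_ord ?ltn_ord // nth_ord_enum //.
Qed.

Lemma in_idealP (k : nat) (l : 'rV[R]_k) (x : R) :
  in_ideal l x <-> exists v, x = lincomb ([seq l 0 i | i : 'I_k] : seq R^o) v.
Proof.
split=> [[mu ->]|[v ->]]; first by exists (rVpoly mu); rewrite dot_row.
exists (poly_rV v); rewrite dot_row; apply: (@eq_lincomb R R^o) => i.
by rewrite size_image card_ord => ik; rewrite (coef_rVpoly_ord _ (Ordinal ik)) mxE.
Qed.

Lemma image_row (l : seq R) : [seq (\row_(i < size l) l`_i) 0 i | i : 'I_(size l)] = l.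
Proof.
apply: (@eq_from_nth _ 0) => [|i]; rewrite size_image card_ord // => il.
by rewrite (nth_map (Ordinal il)) ?size_enum_ord // mxE nth_enum_ord.
Qed.

Lemma Poly_image (k : nat) (v : 'rV[R]_k) : Poly [seq v 0 i | i : 'I_k] = rVpoly v.
Proof.
apply/polyP => i; rewrite coef_Poly; have [ik|ki] := ltnP i k.
  by rewrite -[i]/(val (Ordinal ik)) coef_rVpoly_ord (nth_map (Ordinal ik))
     ?size_enum_ord // nth_ord_enum.
by rewrite !nth_default ?size_image ?card_ord // (leq_trans (size_poly _ _)).
Qed.

Lemma rVpoly_mulmx (r k : nat) (b : 'rV[R]_r) (G : 'M[R]_(r, k)) :
  rVpoly (b *m G) = lincomb [seq rVpoly (row j G) | j : 'I_r] (rVpoly b).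
Proof.
rewrite mulmx_sum_row linear_sum /lincomb size_image card_ord big_mkord.
apply: eq_bigr => j _; rewrite linearZ /= coef_rVpoly_ord.
by rewrite (nth_map j) ?size_enum_ord ?ltn_ord // nth_ord_enum.
Qed.
End Rows.

Lemma finitely_generated_ideals_noetherian (R : comNzRingType) :
  noetherian R -> finitely_generated_ideals R.
Proof.
move=> noethR J /noethR[k [g gJ]]; exists [seq g 0 i | i : 'I_k] => x.
by apply: (iff_trans (gJ x)); apply: in_idealP.
Qed.

Section FromNumbering.
Variables (E : comNzRingType) (nu : nat -> E).
Hypothesis solvE : linear_equations_solvable nu.

Lemma numbering_exists (x : E) : exists n, nu n == x.
Proof.
by have [[surj _ _ _] _ _] := solvE; have [n <-] := surj x; exists n.
Qed.

(** The canonical code needed for [coded]; it is computable once equality of represented elements is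
    decidable. *)
Definition least_code (x : E) : nat := ex_minn (numbering_exists x).

Lemma least_codeK : cancel least_code nu.
Proof. by move=> x; rewrite /least_code; case: ex_minnP => n /eqP. Qed.

Lemma codes_vector_least (l : seq E) :
  codes_vector nu (CodeSeq.code (map least_code l)) (\row_(i < size l) l`_i).
Proof. by rewrite /codes_vector CodeSeq.codeK (mapK least_codeK) image_row. Qed.

(* Membership in the ideal generated by the empty family decides equality. *)
Lemma recursive1_least_code : recursive1 (fun n => least_code (nu n)).
Proof.
have [[_ [add radd addP] [opp ropp oppP] _] [d [s [rd _ dP]]] _] := solvE.
have d0 a b : d (add a (opp b)) 0 <> 0 <-> nu a = nu b.
  have ab : nu (add a (opp b)) = nu a - nu b by rewrite addP oppP.
  have l0 : codes_vector nu 0 (0 : 'rV[E]_0).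
    by apply/esym/size0nil; rewrite size_image card_ord.
  have [dE _] := dP _ _ _ _ _ l0 ab.
  apply: (iff_trans dE); split=> [[mu]|->]; last first.
    by exists 0; rewrite subrr big_ord0.
  by rewrite big_ord0 => /eqP; rewrite subr_eq0 => /eqP.
pose g j n : nat := d (add j (opp n)) 0 == 0.
apply: (recursive2_mu (g := g)).
- apply: (recursive_app1 recursive1_not); apply: (recursive_app2 rd); last exact: recursive_const.
  apply: (recursive_app2 radd); first exact: recursive_proj.
  exact: (recursive_app1 ropp (recursive_proj _)).
- move=> n; rewrite /g; case: eqP => // e0.
  by case: (d0 (least_code (nu n)) n) => _ /(_ (least_codeK _)).
- move=> n j; rewrite /least_code; case: ex_minnP => k _ min jk.
  rewrite /g; case: eqP => // /d0 /eqP /min; by rewrite leqNgt jk.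
Qed.

Definition coded_numbering : coded E := Coded least_codeK recursive1_least_code.

Lemma solvable_numbering : solvable_ring coded_numbering.
Proof.
have [[_ [add radd addP] _ [mul rmul mulP]] [d [s [rd _ dP]]] [g rg gP]] := solvE.
have canon := @recursive1_canon E coded_numbering.
split.
- split.
    have := recursive_app1 canon radd; apply: recursive_ext => v /=.
    by rewrite addP.
  have := recursive_app1 canon rmul; apply: recursive_ext => v /=.
  by rewrite mulP.
- exists (fun x l => d (@enc E coded_numbering x)
                       (@enc (seq E) (coded_seq coded_numbering) l) != 0).
    apply: (recursive_app1 recursive1_canon_bool); apply: (recursive_app2 rd).
      exact: (recursive_app1 canon (recursive_proj _)).
    exact: (recursive_app1 (@recursive1_canon _ (coded_seq coded_numbering)) (recursive_proj _)).
  move=> x l; have [dE _] := dP _ _ x _ (least_code x) (codes_vector_least l) (least_codeK x).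
  have idE := in_idealP (\row_(i < size l) l`_i) x; rewrite image_row in idE.
  by apply: iff_trans idE; apply: iff_trans dE; split=> /eqP.
(* A list of coded rows is, number for number, a code of a list of polynomials, so the output of [g]
   is decoded directly. *)
exists (fun l => @dec (seq {poly E}) (coded_seq (coded_poly coded_numbering))
                  (g (@enc (seq E) (coded_seq coded_numbering) l))).
  apply: (recursive1_comp (@recursive1_canon _ (coded_seq (coded_poly coded_numbering)))).
  exact: (recursive1_comp rg (@recursive1_canon _ (coded_seq coded_numbering))).
move=> l; have [r [G [[sG rowG] genG]]] := gP _ _ _ (codes_vector_least l).
rewrite /=; set c := g _.
have -> : dec_seq (coded_poly coded_numbering) c = [seq rVpoly (row j G) | j : 'I_r].
  apply: (@eq_from_nth _ 0) => [|j]; rewrite size_map ?size_image ?card_ord sG // => jr.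
  rewrite (nth_map 0%N) ?sG // (nth_map (Ordinal jr)) ?size_enum_ord //.
  have := rowG (Ordinal jr); rewrite /codes_vector /= => cj.
  by rewrite -[j]/(val (Ordinal jr)) nth_ord_enum /= -Poly_image -cj.
split=> [q /imageP[j _ ->]|v sv]; first exact: size_poly.
have vK : rVpoly (poly_rV v : 'rV_(size l)) = v by rewrite poly_rV_K.
rewrite -[X in lincomb X v](image_row l) -{1}vK -dot_row; split.
  move/genG => [b vb]; exists (rVpoly b); by rewrite -rVpoly_mulmx -vb vK.
move=> [b vb]; apply/genG; exists (poly_rV b); apply: (can_inj rVpolyK).
rewrite vK vb rVpoly_mulmx; apply: eq_lincomb => j; rewrite size_image card_ord => jr.
by rewrite (coef_rVpoly_ord _ (Ordinal jr)) mxE.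
Qed.
End FromNumbering.

Lemma computable_decode (C : Type) {cC : coded C} (n : C -> nat) :
  computable n -> computable (fun c => CodeSeq.decode (n c)).
Proof.
apply: eq_recursive1 => k /=; by rewrite /enc_seq map_id CodeSeq.decodeK.
Qed.

Lemma computable_code (C : Type) {cC : coded C} (s : C -> seq nat) :
  computable s -> computable (fun c => CodeSeq.code (s c)).
Proof. by apply: eq_recursive1 => k /=; rewrite /enc_seq map_id. Qed.

Lemma computable_recursive1 (f : nat -> nat) : computable f -> recursive1 f.
Proof. by []. Qed.

Lemma computable_recursive2 (f : nat -> nat -> nat) :
  computable (fun p : nat * nat => f p.1 p.2) -> recursive2 f.
Proof. by move/computable2P. Qed.

(** * Passage to a quotient *)

Section Quotient.
Variables (S R : comNzRingType) (cS : coded S) (psi : {rmorphism S -> R}) (T : nat -> S).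
Hypotheses (solvS : solvable_ring cS) (fgS : finitely_generated_ideals S).
Hypotheses (rT : computable T) (surjT : forall x : R, exists n, psi (T n) == x).

Variable nu : nat -> R.
Hypothesis nuE : forall n, nu n = psi (T n).

Definition preimage (x : R) : S := T (xchoose (surjT x)).

Lemma preimageK : cancel preimage psi.
Proof. by move=> x; apply/eqP/(xchooseP (surjT x)). Qed.

Lemma rmorph_lincomb (l : seq S) v :
  psi (lincomb (l : seq S^o) v) = \sum_(i < size l) psi l`_i * psi v`_i.
Proof.
rewrite /lincomb big_mkord rmorph_sum; apply: eq_bigr => i _.
by rewrite mulrC -rmorphM.
Qed.

Lemma kernel_generators : exists K : seq S, forall x : S,
  psi x = 0 <-> exists v, x = lincomb (K : seq S^o) v.
Proof.
have [|K KP] := fgS (J := fun x => psi x = 0); last by exists K.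
split=> [|x y px py|r x px]; first exact: rmorph0.
  by rewrite rmorphD /= px py addr0.
by rewrite rmorphM /= px mulr0.
Qed.

Section WithKernel.
Variable K : seq S.
Hypothesis KP : forall x : S, psi x = 0 <-> exists v, x = lincomb (K : seq S^o) v.

Lemma rmorph_lincomb_cat (l : seq S) v :
  psi (lincomb ((l ++ K) : seq S^o) v) = \sum_(i < size l) psi l`_i * psi v`_i.
Proof.
rewrite (lincomb_cat (l : seq S^o)) rmorphD /= rmorph_lincomb.
rewrite [X in _ + X](_ : _ = 0) ?addr0 //.
by apply/KP; exists (drop_poly (size l) v).
Qed.

(** The coefficients are lifted arbitrarily; the resulting error lies in the kernel and is absorbed
    by the generators [K]. *)
Lemma lift_row (k : nat) (l : seq S) (mu : 'rV[R]_k) (x : S) : size l = k ->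
  psi x = \sum_(i < k) psi l`_i * mu 0 i ->
  exists v, x = lincomb ((l ++ K) : seq S^o) v /\ forall i : 'I_k, psi v`_i = mu 0 i.
Proof.
move=> lk xE; pose v := rVpoly (map_mx preimage mu).
have vE (i : 'I_k) : psi v`_i = mu 0 i by rewrite coef_rVpoly_ord mxE preimageK.
have [w xw] : exists w, x - lincomb (l : seq S^o) v = lincomb (K : seq S^o) w.
  apply/KP; rewrite rmorphB /= rmorph_lincomb xE lk; apply/eqP; rewrite subr_eq0.
  by apply/eqP/eq_bigr => i _; rewrite vE.
exists (take_poly (size l) v + w * 'X^(size l)); split.
  by rewrite (lincomb_cat_take (l : seq S^o)) -xw addrC subrK.
by move=> i; rewrite coefD coefMXn coef_take_poly lk ltn_ord addr0.
Qed.

Section Vector.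
Variables (k : nat) (l : 'rV[R]_k) (cl : nat).
Hypothesis lcl : codes_vector nu cl l.

Lemma size_decode_codes : size (CodeSeq.decode cl) = k.
Proof. by have := congr1 size lcl; rewrite size_map size_image card_ord. Qed.

Lemma nth_codes_vector (i : 'I_k) : psi [seq T n | n <- CodeSeq.decode cl]`_i = l 0 i.
Proof.
have ik : (i < size (CodeSeq.decode cl))%N by rewrite size_decode_codes.
have := congr1 (fun s => nth 0 s i) lcl.
rewrite (nth_map 0%N) // (nth_map i) ?size_enum_ord // nth_ord_enum => <-.
by rewrite (nth_map 0%N) // nuE.
Qed.

Lemma in_ideal_lift (x : S) : in_ideal l (psi x) <->
  exists v, x = lincomb (([seq T n | n <- CodeSeq.decode cl] ++ K) : seq S^o) v.
Proof.
set ls := map T _; have sl : size ls = k by rewrite size_map size_decode_codes.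
split=> [[mu xE]|[v ->]].
  have [|v [xv _]] := @lift_row k ls mu x sl; last by exists v.
  by rewrite xE; apply: eq_bigr => i _; rewrite nth_codes_vector.
exists (\row_(i < k) psi v`_i); rewrite rmorph_lincomb_cat sl.
by apply: eq_bigr => i _; rewrite nth_codes_vector mxE.
Qed.
End Vector.

Lemma codes_vector_mkseq (u : S -> nat) (k : nat) (f : nat -> S) :
  (forall x, psi (T (u x)) = psi x) ->
  codes_vector nu (CodeSeq.code (mkseq (fun i => u (f i)) k)) (\row_(i < k) psi (f i)).
Proof.
move=> uP; rewrite /codes_vector CodeSeq.codeK -map_comp.
apply: (@eq_from_nth _ 0) => [|i]; rewrite size_map ?size_image ?size_iota ?card_ord // => ik.
rewrite (nth_map 0%N) ?size_iota // nth_iota // (nth_map (Ordinal ik)) ?size_enum_ord //.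
by rewrite /= nuE uP mxE nth_enum_ord.
Qed.

End WithKernel.

Theorem solvable_quotient : linear_equations_solvable nu.
Proof.
have [K KP] := kernel_generators.
have [oS [d rd dP] [syz rsyz syzP]] := solvS.
(* Only [psi \o T] is known to be surjective, so a code for the image of an element of S is searched
   for modulo the kernel, with membership in the ideal of [K] as the test. *)
have [|x|u ru uP] := @computable_search _ _ _ _ (fun x n => d (x - T n) K).
- by apply/computable2P; comp.
- have [n /eqP nx] := surjT (psi x); exists n; apply/dP/KP.
  by rewrite rmorphB /= nx subrr.
have {}uP x : psi (T (u x)) = psi x.
  have /dP/KP := uP x; rewrite rmorphB /= => /eqP; rewrite subr_eq0 => /eqP ->//.
(* Coefficients are found by search; non-members are accepted with any vector, to keep the search
   total. *)
have [|[x l] /=|sol rsol solP] := @computable_search _ _ _ _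
    (fun (c : S * seq S) (v : {poly S}) =>
       ~~ d c.1 c.2 || (c.1 == lincomb (c.2 : seq S^o) v)).
- by apply/computable2P; apply: computable_if; comp.
- have [/dP[v xv]|_] := boolP (d x l); last by exists 0.
  by exists v; rewrite -xv eqxx.
have {}solP x l : d x l -> x = lincomb (l : seq S^o) (sol (x, l)).
  by move=> dxl; have := solP (x, l); rewrite /= dxl => /eqP.
(* An equation over R becomes one over S with the kernel generators as additional coefficients. *)
pose lift cl := [seq T n | n <- CodeSeq.decode cl] ++ K.
have rlift : computable lift.
  by rewrite /lift; comp; apply: computable_decode; comp.
split.
- split.
  + by move=> x; have [n /eqP] := surjT x; exists n; rewrite nuE.
  + exists (fun a b => u (T a + T b)); first by apply: computable_recursive2; comp.
    by move=> a b; rewrite !nuE uP rmorphD.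
  + exists (fun a => u (- T a)); first by apply: computable_recursive1; comp.
    by move=> a; rewrite !nuE uP rmorphN.
  + exists (fun a b => u (T a * T b)); first by apply: computable_recursive2; comp.
    by move=> a b; rewrite !nuE uP rmorphM.
- exists (fun cx cl => d (T cx) (lift cl) : nat).
  exists (fun cx cl => CodeSeq.code (mkseq (fun i => u (sol (T cx, lift cl))`_i)
                                 (size (CodeSeq.decode cl)))).
  split.
  + apply: computable_recursive2.
    by change (computable (fun p : nat * nat => d (T p.1) (lift p.2))); comp.
  + apply: computable_recursive2; apply: computable_code; comp;
    by apply: computable_decode; comp.
  move=> k l x cl cx lcl <-; rewrite nuE.
  have iE := in_ideal_lift KP lcl (T cx).
  have dE : (d (T cx) (lift cl) : nat) <> 0%N <-> in_ideal l (psi (T cx)).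
    apply: iff_trans (iff_sym iE); apply: iff_trans (dP _ _).
    by case: (d _ _).
  split=> // /iE/dP dx.
  exists (\row_(i < k) psi (sol (T cx, lift cl))`_i).
    by rewrite (size_decode_codes lcl); apply: codes_vector_mkseq.
  rewrite {1}(solP _ _ dx) rmorph_lincomb_cat // size_map (size_decode_codes lcl).
  by apply: eq_bigr => i _; rewrite (nth_codes_vector lcl) mxE.
(* Only the first k coordinates of a syzygy are kept; those at [K] contribute elements of the
   kernel. *)
exists (fun cl => CodeSeq.code [seq CodeSeq.code (mkseq (fun i => u (q : {poly S})`_i)
                      (size (CodeSeq.decode cl))) | q <- syz (lift cl)]).
  apply: computable_recursive1.
  apply: computable_code; comp; apply: computable_code; comp.
  by apply: computable_decode; comp.
move=> k l cl lcl; set gs := syz (lift cl).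
have [sgs genG] := syzP (lift cl); rewrite -/gs in sgs genG.
have sk := size_decode_codes lcl.
exists (size gs), (\matrix_(j < size gs, i < k) psi (gs`_j)`_i).
split.
  split=> [|j]; rewrite CodeSeq.codeK ?size_map // (nth_map 0) // sk.
  have -> : row j (\matrix_(j < size gs, i < k) psi (gs`_j)`_i) =
            \row_(i < k) psi (gs`_j)`_i by apply/rowP => i; rewrite !mxE.
  exact: codes_vector_mkseq.
have coefgs v i : (lincomb gs v)`_i = \sum_(j < size gs) v`_j * (gs`_j)`_i.
  by rewrite /lincomb big_mkord coef_sum; apply: eq_bigr => j _; rewrite coefZ.
move=> mu; split=> [lmu|[b ->]].
  have sl : size [seq T n | n <- CodeSeq.decode cl] = k by rewrite size_map.
  have [|v [v0 vmu]] := @lift_row K KP k _ mu 0 sl.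
    rewrite rmorph0 -[LHS]lmu; apply: eq_bigr => i _; by rewrite (nth_codes_vector lcl).
  have [|w wE] := (genG (take_poly (size (lift cl)) v) (size_take_poly _ _)).1.
    by rewrite (lincomb_take (lift cl : seq S^o)) [RHS]v0.
  exists (\row_j psi w`_j); apply/rowP => i; rewrite mxE -vmu.
  have -> : v`_i = (lincomb gs w)`_i.
    by rewrite -wE coef_take_poly size_cat sl (leq_trans (ltn_ord i)) ?leq_addr.
  by rewrite coefgs rmorph_sum; apply: eq_bigr => j _; rewrite !mxE rmorphM.
pose w := rVpoly (map_mx preimage b).
have : psi (lincomb (lift cl : seq S^o) (lincomb gs w)) = 0.
  rewrite (_ : lincomb _ _ = 0) ?rmorph0 //; apply/genG; last by exists w.
  exact: size_lincomb.
rewrite rmorph_lincomb_cat // size_map sk => e.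
rewrite /syzygy -[RHS]e; apply: eq_bigr => i _.
rewrite (nth_codes_vector lcl) coefgs rmorph_sum mxE; congr (_ * _).
by apply: eq_bigr => j _; rewrite rmorphM /= coef_rVpoly_ord !mxE preimageK.
Qed.
End Quotient.

(** * Iterated polynomial rings over E *)

Section Tower.
Variables (E R : comNzRingType) (phi : {rmorphism E -> R}) (cE : coded E).
Hypotheses (noethE : finitely_generated_ideals E) (solvE : solvable_ring cE).

(** E[y_1, ..., y_m] as an iterated univariate polynomial ring, with its evaluation at [a]. Indexing
    [a] by all naturals lets the induction on [m] keep it fixed. *)
Record polynomial_tower (m : nat) (a : nat -> R) : Type := PolynomialTower {
  tower : comNzRingType;
  tower_coded : coded tower;
  tower_const : E -> tower;
  tower_var : nat -> tower;
  tower_eval : {rmorphism tower -> R};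
  tower_solvable : solvable_ring tower_coded;
  tower_noetherian : finitely_generated_ideals tower;
  tower_const_computable : computable tower_const;
  tower_eval_const : forall e, tower_eval (tower_const e) = phi e;
  tower_eval_var : forall i, (i < m)%N -> tower_eval (tower_var i) = a i
}.

Lemma polynomial_tower_exists m a : polynomial_tower m a.
Proof.
elim: m => [|m [S cS iota y psi solvS noethS riota psii psiy]].
  apply: (@PolynomialTower 0 a E cE id (fun=> 0) phi) => //.
  exact: computable_id.
exists {poly S} (coded_poly cS) (fun e => (iota e)%:P)
  (fun i => if i == m then 'X else (y i)%:P) (horner_eval (a m) \o map_poly psi).
- exact: solvable_poly.
- exact: hilbert_basis.
- exact: computable_polyC.
- by move=> e; rewrite /= map_polyC /horner_eval hornerC; apply: psii.
- move=> i; rewrite ltnS /= /horner_eval; case: eqP => [->|/eqP im] lim.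
    by rewrite map_polyX hornerX.
  by rewrite map_polyC hornerC; apply: psiy; rewrite ltn_neqAle im.
Qed.
End Tower.

Lemma computable_exp (R : comNzRingType) {cR : coded R} {oR : computable_ops R}
    (C : Type) {cC : coded C} (x : R) (n : C -> nat) :
  computable n -> computable (fun c => x ^+ n c).
Proof.
move=> rn; have r : computable (fun c => iteri (n c) (fun _ z => x * z) 1).
  by apply: computable_iteri; comp.
by apply: eq_computable r => c; elim: (n c) => //= k ->; rewrite exprS.
Qed.

Lemma computable_monomial (R : comNzRingType) {cR : coded R} {oR : computable_ops R}
    (C : Type) {cC : coded C} (y : nat -> R) (m : nat) (k : C -> nat -> nat) :
  (forall i, computable (fun c => k c i)) ->
  computable (fun c => \prod_(0 <= i < m) y i ^+ k c i).
Proof.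
move=> rk; elim: m => [|m IHm].
  by apply: (eq_computable (f := fun=> 1)) => [c|]; [rewrite big_geq | comp].
have r : computable (fun c => (\prod_(0 <= i < m) y i ^+ k c i) * y m ^+ k c m).
  by comp; apply: computable_exp.
by apply: eq_computable r => c; rewrite big_nat_recr.
Qed.

Lemma algebra_numbering_surjective (E R : comPzRingType) (phi : {rmorphism E -> R})
    (m : nat) (a : 'I_m -> R) (nu : nat -> E) :
  (forall e, exists n, nu n == e) -> generates_algebra phi a ->
  forall x, exists n, algebra_numbering phi a nu n == x.
Proof.
move=> surj gen x; have [p <-] := gen x.
pose code_term (t : E * {ffun 'I_m -> nat}) :=
  CodeSeq.code (xchoose (surj t.1) :: [seq t.2 i | i : 'I_m]).
exists (CodeSeq.code (map code_term p)).
rewrite /algebra_numbering /decode_poly CodeSeq.codeK -map_comp.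
rewrite (eq_map (g := id)) ?map_id // => -[e k].
rewrite /= /decode_term CodeSeq.codeK /=; congr pair.
  exact/eqP/(xchooseP (surj e)).
by apply/ffunP => i; rewrite ffunE /= (nth_map i) ?size_enum_ord // nth_ord_enum.
Qed.

Section Nontrivial.
Variables (E R : comNzRingType) (phi : {rmorphism E -> R}).
Variables (m : nat) (a : 'I_m -> R) (nu : nat -> E).

Lemma solvable_algebra_nontrivial :
  noetherian E -> generates_algebra phi a -> linear_equations_solvable nu ->
  linear_equations_solvable (algebra_numbering phi a nu).
Proof.
move=> /finitely_generated_ideals_noetherian noethE gen solvE.
pose cE := coded_numbering solvE.
pose a' i := oapp a 0 (insub i).
have [S cS iota y psi solvS noethS riota psii psiy] :=
  polynomial_tower_exists phi noethE (solvable_numbering solvE) m a'.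
(* A coded polynomial is read in the tower instead of in R, so that the numbering of R factors as
   [psi \o T] with [T] computable. *)
pose T c := \sum_(t <- CodeSeq.decode c)
  iota (nu (nth 0%N (CodeSeq.decode t) 0)) *
  \prod_(0 <= i < m) y i ^+ nth 0%N (CodeSeq.decode t) i.+1.
have TE c : algebra_numbering phi a nu c = psi (T c).
  rewrite /algebra_numbering /poly_eval /decode_poly big_map rmorph_sum.
  apply: eq_bigr => t _; rewrite rmorphM /= psii rmorph_prod big_mkord; congr (_ * _).
  apply: eq_bigr => i _; rewrite rmorphXn /= psiy // /a' ffunE.
  by rewrite (insubT (fun j => j < m)%N (ltn_ord i)) /=; congr (a _ ^+ _); apply: val_inj.
have oS := solvable_ops solvS.
apply: (solvable_quotient solvS noethS (T := T) _ _ TE).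
- apply: computable_sum; [exact: computable_addr | by apply: computable_decode; comp|].
  have rt (i : nat) : computable (fun p : nat * nat => nth 0%N (CodeSeq.decode p.2) i).
    by comp; apply: computable_decode; comp.
  apply: computable_mulR; last exact: computable_monomial.
  exact: (computable_app riota (computable_dec (cX := cE) (rt 0%N))).
- move=> x; have [n /eqP <-] := algebra_numbering_surjective (numbering_exists solvE) gen x.
  by exists n; rewrite TE.
Qed.
End Nontrivial.

(** * The zero ring *)

Lemma solvable_trivial (R : comPzRingType) (nu : nat -> R) :
  (1 : R) = 0 -> linear_equations_solvable nu.
Proof.
move=> R0; have eqR (x y : R) : x = y by rewrite -[x]mul1r -[y]mul1r R0 !mul0r.
split.
- split; first by move=> x; exists 0%N.
  + by exists (fun _ _ => 0%N) => //; apply: recursive_const.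
  + by exists (fun _ => 0%N) => //; apply: recursive_const.
  + by exists (fun _ _ => 0%N) => //; apply: recursive_const.
(* The coefficient vector must be coded by a list of the right length, which the input [cl] already
   has. *)
- exists (fun _ _ => 1%N), (fun _ cl => cl); split.
  + exact: recursive_const.
  + exact: recursive_proj.
  move=> k l x cl cx lcl _; split; last first.
    by move=> _; exists l; [exact: lcl | exact: eqR].
  by split=> // _; exists 0; apply: eqR.
exists (fun=> 0%N); first exact: recursive_const.
move=> k l cl _; exists 0%N, 0; split; first by split=> // -[].
move=> mu; split=> _; last exact: eqR.
by exists 0; apply/rowP => i; apply: eqR.
Qed.

Definition nontrivial_ring (R : comPzRingType) (R1 : (1 : R) != 0) : comNzRingType :=
  HB.pack (GRing.ComPzRing.sort R) (GRing.PzSemiRing_isNonZero.Build R R1).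

(** An equality of bundled structures, not merely an isomorphism: the types of [phi], [a] and [nu]
    can be rewritten along it. *)
Lemma nontrivial_ringE (R : comPzRingType) (R1 : (1 : R) != 0) :
  (nontrivial_ring R1 : comPzRingType) = R.
Proof. by case: R R1 => R [? ? ? ? ? ? ? ? ? ?] R1. Qed.

Theorem proposition4p1 (E R : comPzRingType) (phi : {rmorphism E -> R})
    (m : nat) (a : 'I_m -> R) (nu : nat -> E) :
  noetherian E ->
  generates_algebra phi a ->
  linear_equations_solvable nu ->
  linear_equations_solvable (algebra_numbering phi a nu).
Proof.
have [R0 _ _ _|R1] := eqVneq (1 : R) 0; first exact: solvable_trivial.
have E1 : (1 : E) != 0.
  by apply: contraNneq R1 => e; rewrite -(rmorph1 phi) e rmorph0.
move: phi a nu; rewrite -(nontrivial_ringE E1) -(nontrivial_ringE R1).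
move=> phi a nu; exact: solvable_algebra_nontrivial.
Qed.
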